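(* Up to conjugation by elements of $\mathrm{GL}(2,\mathbb{R})$ (embedded in $\mathrm{Sp}(2,\mathbb{R})$ via $g\mapsto \mathrm{diag}(g,{}^t g^{-1})$), any group $G$ in the class $\mathcal{E}_2$ is one of the following groups $\Sigma\rtimes H$. a) $5$-dimensional groups: 1. $\left\{\begin{bmatrix}0&u\\ u&v\end{bmatrix}:u,v\in\mathbb{R}\right\}\rtimes\left\{\begin{bmatrix}e^t&r\\ 0&e^s\end{bmatrix}:t,s,r\in\mathbb{R}\right\}$. b) $4$-dimensional groups: 1. $\left\{\begin{bmatrix}u&v\\ v&-u\end{bmatrix}:u,v\in\mathbb{R}\right\}\rtimes\left\{e^t\begin{bmatrix}\cos\theta&-\sin\theta\\ \sin\theta&\cos\theta\end{bmatrix}:t\in\mathbb{R},\theta\in\mathbb{T}\right\}$; 2. $\left\{\begin{bmatrix}u&0\\ 0&0\end{bmatrix}:u\in\mathbb{R}\right\}\rtimes\left\{\begin{bmatrix}e^t&0\\ r&e^s\end{bmatrix}:t,s,r\in\mathbb{R}\right\}$; 3. $\left\{\begin{bmatrix}0&u\\ u&v\end{bmatrix}:u,v\in\mathbb{R}\right\}\rtimes\left\{\begin{bmatrix}e^{t\lambda}&s\\ 0&e^{t(\lambda+1)}\end{bmatrix}:t,s\in\mathbb{R}\right\}$, with $\lambda\in\mathbb{R}$; 4. $\left\{\begin{bmatrix}0&u\\ u&v\end{bmatrix}:u,v\in\mathbb{R}\right\}\rtimes\left\{\begin{bmatrix}e^t&0\\ 0&e^s\end{bmatrix}:t,s\in\mathbb{R}\right\}$;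 5. $\left\{\begin{bmatrix}0&u\\ u&v\end{bmatrix}:u,v\in\mathbb{R}\right\}\rtimes\left\{\begin{bmatrix}e^t&s\\ 0&e^t\end{bmatrix}:t,s\in\mathbb{R}\right\}$; 6. $\left\{\begin{bmatrix}u&0\\ 0&v\end{bmatrix}:u,v\in\mathbb{R}\right\}\rtimes\left\{\begin{bmatrix}e^t&0\\ 0&e^s\end{bmatrix}:t,s\in\mathbb{R}\right\}$. c) $3$-dimensional groups: 1. $\left\{\begin{bmatrix}u&0\\ 0&u\end{bmatrix}:u\in\mathbb{R}\right\}\rtimes\left\{e^t\begin{bmatrix}\cos\theta&-\sin\theta\\ \sin\theta&\cos\theta\end{bmatrix}:t\in\mathbb{R},\theta\in\mathbb{T}\right\}$; 2. $\left\{\begin{bmatrix}u&v\\ v&-u\end{bmatrix}:u,v\in\mathbb{R}\right\}\rtimes\left\{e^t\begin{bmatrix}\cos t\alpha&-\sin t\alpha\\ \sin t\alpha&\cos t\alpha\end{bmatrix}:t\in\mathbb{R}\right\}$, with $\alpha\ge0$; 3. $\left\{\begin{bmatrix}u&v\\ v&-u\end{bmatrix}:u,v\in\mathbb{R}\right\}\rtimes\left\{\begin{bmatrix}\cos\theta&-\sin\theta\\ \sin\theta&\cos\theta\end{bmatrix}:\theta\in\mathbb{T}\right\}$; 4. $\left\{\begin{bmatrix}u&0\\ 0&0\end{bmatrix}:u\in\mathbb{R}\right\}\rtimes\left\{\begin{bmatrix}e^{t\lambda}&0\\ s&e^{t(\lambda+1)}\end{bmatrix}:t,s\in\mathbb{R}\right\}$,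 with $\lambda\in\mathbb{R}$; 5. $\left\{\begin{bmatrix}u&0\\ 0&0\end{bmatrix}:u\in\mathbb{R}\right\}\rtimes\left\{\begin{bmatrix}e^t&0\\ 0&e^s\end{bmatrix}:t,s\in\mathbb{R}\right\}$; 6. $\left\{\begin{bmatrix}u&0\\ 0&0\end{bmatrix}:u\in\mathbb{R}\right\}\rtimes\left\{\begin{bmatrix}e^t&0\\ s&e^t\end{bmatrix}:t,s\in\mathbb{R}\right\}$; 7. $\left\{\begin{bmatrix}0&u\\ u&v\end{bmatrix}:u,v\in\mathbb{R}\right\}\rtimes\left\{e^{t\lambda}\begin{bmatrix}1&0\\ 0&e^t\end{bmatrix}:t\in\mathbb{R}\right\}$, with $\lambda\in\mathbb{R}$; 8. $\left\{\begin{bmatrix}0&u\\ u&v\end{bmatrix}:u,v\in\mathbb{R}\right\}\rtimes\left\{\begin{bmatrix}1&t\\ 0&1\end{bmatrix}:t\in\mathbb{R}\right\}$; 9. $\left\{\begin{bmatrix}0&u\\ u&v\end{bmatrix}:u,v\in\mathbb{R}\right\}\rtimes\left\{e^t\begin{bmatrix}1&t\\ 0&1\end{bmatrix}:t\in\mathbb{R}\right\}$; 10. $\left\{\begin{bmatrix}0&u\\ u&v\end{bmatrix}:u,v\in\mathbb{R}\right\}\rtimes\left\{\begin{bmatrix}e^t&0\\ 0&e^t\end{bmatrix}:t\in\mathbb{R}\right\}$; 11. $\left\{\begin{bmatrix}0&u\\ u&0\end{bmatrix}:u\in\mathbb{R}\right\}\rtimes\left\{\begin{bmatrix}e^t&0\\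 0&e^s\end{bmatrix}:t,s\in\mathbb{R}\right\}$; 12. $\left\{\begin{bmatrix}u&0\\ 0&v\end{bmatrix}:u,v\in\mathbb{R}\right\}\rtimes\left\{\begin{bmatrix}e^t&0\\ 0&e^{t\beta}\end{bmatrix}:t\in\mathbb{R}\right\}$, with $\beta\in[-1,1]$. d) $2$-dimensional groups: 1. $\left\{\begin{bmatrix}u&0\\ 0&u\end{bmatrix}:u\in\mathbb{R}\right\}\rtimes\left\{e^t\begin{bmatrix}\cos t\alpha&-\sin t\alpha\\ \sin t\alpha&\cos t\alpha\end{bmatrix}:t\in\mathbb{R}\right\}$, with $\alpha\ge0$; 2. $\left\{\begin{bmatrix}u&0\\ 0&u\end{bmatrix}:u\in\mathbb{R}\right\}\rtimes\left\{\begin{bmatrix}\cos\theta&-\sin\theta\\ \sin\theta&\cos\theta\end{bmatrix}:\theta\in\mathbb{T}\right\}$; 3. $\left\{\begin{bmatrix}u&0\\ 0&0\end{bmatrix}:u\in\mathbb{R}\right\}\rtimes\left\{e^{t\lambda}\begin{bmatrix}1&0\\ 0&e^t\end{bmatrix}:t\in\mathbb{R}\right\}$, with $\lambda\in\mathbb{R}$; 4. $\left\{\begin{bmatrix}u&0\\ 0&0\end{bmatrix}:u\in\mathbb{R}\right\}\rtimes\left\{\begin{bmatrix}1&0\\ t&1\end{bmatrix}:t\in\mathbb{R}\right\}$; 5. $\left\{\begin{bmatrix}u&0\\ 0&0\end{bmatrix}:u\in\mathbb{R}\right\}\rtimes\left\{e^t\begin{bmatrix}1&0\\ t&1\end{bmatrix}:t\in\mathbb{R}\right\}$;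 6. $\left\{\begin{bmatrix}u&0\\ 0&0\end{bmatrix}:u\in\mathbb{R}\right\}\rtimes\left\{\begin{bmatrix}e^t&0\\ 0&e^t\end{bmatrix}:t\in\mathbb{R}\right\}$; 7. $\left\{\begin{bmatrix}0&u\\ u&0\end{bmatrix}:u\in\mathbb{R}\right\}\rtimes\left\{\begin{bmatrix}e^t&0\\ 0&e^{t\beta}\end{bmatrix}:t\in\mathbb{R}\right\}$, with $\beta\in[-1,1]$. None of the groups in the list formed by a), b), c) and d) is conjugate to any other in the list modulo $\mathrm{GL}(2,\mathbb{R})$ (groups in the same family with different values of the parameter $\lambda$, $\alpha$ or $\beta$ being regarded as different members of the list).
   Context: $\mathrm{Sp}(2,\mathbb{R})=\{g\in\mathrm{GL}(4,\mathbb{R}):{}^tgJg=J\}$ with $J=\begin{bmatrix}0&I\\ -I&0\end{bmatrix}$ (blocks of size $2\times2$), where ${}^t$ denotes transpose. $\mathrm{Sym}(2,\mathbb{R})$ is the vector space of real symmetric $2\times 2$ matrices. The standard maximal parabolic subgroup of $\mathrm{Sp}(2,\mathbb{R})$ is $$Q=\left\{\begin{bmatrix}h&0\\ \sigma h&{}^th^{-1}\end{bmatrix}:h\in\mathrm{GL}(2,\mathbb{R}),\ \sigma\in\mathrm{Sym}(2,\mathbb{R})\right\}.$$ Writing such an element as $(\sigma,h)$, the product is $(\sigma,h)(\sigma',h')=(\sigma+h^\dagger(\sigma'),hh')$, where $h^\dagger(\sigma)={}^th^{-1}\sigma h^{-1}$; thus $Q=\mathrm{Sym}(2,\mathbb{R})\rtimes\mathrm{GL}(2,\mathbb{R})$.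 For a vector subspace $\Sigma\subset\mathrm{Sym}(2,\mathbb{R})$ and a subgroup $H\subset\mathrm{GL}(2,\mathbb{R})$ with $h^\dagger(\Sigma)=\Sigma$ for all $h\in H$, $\Sigma\rtimes H$ denotes the subgroup $\{(\sigma,h):\sigma\in\Sigma,\ h\in H\}$ of $Q$. The class $\mathcal{E}_2$ is the family of all subgroups of $Q$ of the form $\Sigma\rtimes H$, where $\Sigma$ is a vector subspace with $0\neq\Sigma\subsetneq\mathrm{Sym}(2,\mathbb{R})$ and $H$ is a connected Lie subgroup of $\mathrm{GL}(2,\mathbb{R})$ with $H\neq\{1\}$ (leaving $\Sigma$ invariant, i.e. $h^\dagger(\Sigma)=\Sigma$ for all $h\in H$). Conjugation by $g\in\mathrm{GL}(2,\mathbb{R})$ means conjugation by $\mathrm{diag}(g,{}^tg^{-1})\in Q$; it sends $\Sigma\rtimes H$ to $({}^tg^{-1}\Sigma g^{-1})\rtimes(gHg^{-1})$. $\mathbb{T}=\mathbb{R}/2\pi\mathbb{Z}$. *)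

(* Defs.v *)
From mathcomp Require Import all_boot all_order all_algebra.
From mathcomp Require Import all_classical all_reals all_analysis.

Set Implicit Arguments.
Unset Strict Implicit.
Unset Printing Implicit Defensive.

Import Order.TTheory GRing.Theory Num.Theory.
Import numFieldNormedType.Exports.

Local Open Scope classical_set_scope.
Local Open Scope ring_scope.

Section LieGroups.
Context {R : realType} {n : nat}.
Implicit Types (G : set 'M[R]_n) (X Y : 'M[R]_n).

(* The exponential series converges for every X, so limn is its actual sum. *)
Definition expmx X : 'M[R]_n :=
  limn (series (fun k => (k`!%:R)^-1 *: X ^+ k)).

Definition GL : set 'M[R]_n := [set g | g \in unitmx].

Definition subgroup_GL G : Prop :=
  [/\ G `<=` GL, G 1%:M,
      forall g h, G g -> G h -> G (g *m h)
    & forall g, G g -> G (invmx g)].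

Definition conj_set (a : 'M[R]_n) G : set 'M[R]_n :=
  [set a *m x *m invmx a | x in G].

Definition lie_algebra G : set 'M[R]_n :=
  [set X | forall t : R, G (expmx (t *: X))].

(* The dimension of a Lie group is that of its Lie algebra. *)
Definition has_dimension G (d : nat) : Prop :=
  exists2 V : {vspace 'M[R]_n}, lie_algebra G = [set` V] & \dim V = d.

(* Connected Lie subgroups are not required to be closed, so the definition
   is not topological.  It is the usual one for matrix groups (B. C. Hall,
   Lie Groups, Lie Algebras, and Representations, 2nd ed., Definition 5.19):
   the Lie algebra of H is a Lie subalgebra of gl(n,R) and every element of H
   is a finite product of exponentials of elements of it. *)
Definition connected_lie_subgroup G : Prop :=
  [/\ subgroup_GL G,
      exists2 V : {vspace 'M[R]_n}, lie_algebra G = [set` V] &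
        forall X Y, X \in V -> Y \in V -> X *m Y - Y *m X \in V
    & forall g, G g -> exists2 s : seq 'M[R]_n,
        (forall X, X \in s -> lie_algebra G X) & g = \prod_(X <- s) expmx X].

End LieGroups.

Arguments GL : clear implicits.

Section Symplectic.
Context {R : realType}.
Implicit Types (h g s : 'M[R]_2) (S H : set 'M[R]_2).

Definition Jmx : 'M[R]_4 := block_mx (0 : 'M[R]_2) 1%:M (- 1%:M) (0 : 'M[R]_2).

Definition Sp2 : set 'M[R]_4 := [set g | GL R 4 g /\ g^T *m Jmx *m g = Jmx].

Definition Sym2 : set 'M[R]_2 := [set s | s^T = s].

Definition Qelt s h : 'M[R]_4 := block_mx h 0 (s *m h) (invmx (h^T)).

Definition Q : set 'M[R]_4 :=
  [set x | exists s h, [/\ Sym2 s, GL R 2 h & x = Qelt s h]].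

Definition embGL g : 'M[R]_4 := block_mx g 0 0 (invmx (g^T)).

Definition dagger h s : 'M[R]_2 := invmx (h^T) *m s *m invmx h.

Definition semidirect S H : set 'M[R]_4 :=
  [set x | exists s h, [/\ S s, H h & x = Qelt s h]].

Definition E2 (G : set 'M[R]_4) : Prop :=
  [/\ subgroup_GL G, G `<=` Q &
   exists (Sigma : {vspace 'M[R]_2}) (H : set 'M[R]_2),
     [/\ Sigma != 0%VS, [set` Sigma] `<` Sym2,
         connected_lie_subgroup H, H <> [set 1%:M]
       & (forall h, H h -> dagger h @` [set` Sigma] = [set` Sigma]) /\
         G = semidirect [set` Sigma] H]].

Definition conjugate_GL2 (G G' : set 'M[R]_4) : Prop :=
  exists2 g, GL R 2 g & conj_set (embGL g) G = G'.

Lemma embGLE g : embGL g = Qelt 0 g.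
Proof. by rewrite /embGL /Qelt mul0mx. Qed.

Lemma Q_sub_Sp2 : Q `<=` Sp2.
Proof.
move=> _ [s [h [ss hu ->]]]; rewrite /GL /= in hu; split.
  rewrite /GL /= unitmxE (@det_lblock _ 2 2) det_inv det_tr.
  by move: hu; rewrite unitmxE => hu; rewrite divrr ?unitr1.
rewrite /Qelt /Jmx (@tr_block_mx _ 2 2 2 2) !(@mulmx_block _ 2 2 2 2 2 2).
rewrite !trmx0 !mulmx0 !mul0mx !add0r !addr0 mulmx1 !mulmxN !mulmx1.
rewrite !mul0mx addr0 mulmxV ?unitmx_tr// !mulNmx trmx_mul ss mulmxA addNr.
by rewrite trmx_inv trmxK mulVmx.
Qed.

Lemma QeltM s h s' h' : GL R 2 h -> GL R 2 h' ->
  Qelt s h *m Qelt s' h' = Qelt (s + dagger h s') (h *m h').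
Proof.
rewrite /GL /= => hu hu'; rewrite /Qelt /dagger (@mulmx_block _ 2 2 2 2 2 2).
have invM : invmx (h'^T *m h^T) = invmx (h^T) *m invmx (h'^T).
  by apply: (@invrM 'M[R]_2); rewrite [_ \in _]unitmx_tr.
rewrite !mulmx0 !mul0mx !addr0 !add0r !mulmxDl !mulmxA trmx_mul invM.
by rewrite mulmxKV.
Qed.

Lemma embGL_conj g s h : GL R 2 g -> GL R 2 h ->
  embGL g *m Qelt s h *m invmx (embGL g) =
  Qelt (dagger g s) (g *m h *m invmx g).
Proof.
move=> gu hu; have ghu : GL R 2 (g *m h *m invmx g).
  by rewrite /GL /= in gu hu *; rewrite !unitmx_mul unitmx_inv gu hu.
have eu : embGL g \in unitmx.
  by rewrite embGLE; apply: (proj1 (Q_sub_Sp2 _)); exists 0, g; split;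
    rewrite // /Sym2 /= trmx0.
rewrite -[RHS](mulmxK eu); congr (_ *m _); rewrite embGLE !QeltM//.
rewrite /dagger !mulmx0 !mul0mx add0r addr0 mulmxKV//.
Qed.

End Symplectic.

Section List.
Context {R : realType}.

Definition mx22 (p q r s : R) : 'M[R]_2 :=
  \matrix_(i, j) if i == 0 then (if j == 0 then p else q)
                 else (if j == 0 then r else s).

(* Angles range over R instead of R/2piZ: only the image of rot is used. *)
Definition rot (x : R) : 'M[R]_2 := mx22 (cos x) (- sin x) (sin x) (cos x).

(* Members with different parameters are different values of this type. *)
Inductive member : Type :=
| a1
| b1 | b2 | b3 of R | b4 | b5 | b6
| c1 | c2 of R | c3 | c4 of R | c5 | c6 | c7 of R | c8 | c9 | c10 | c11
| c12 of R
| d1 of R | d2 | d3 of R | d4 | d5 | d6 | d7 of R.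

Definition admissible (m : member) : Prop :=
  match m with
  | c2 al | d1 al => 0 <= al
  | c12 be | d7 be => -1 <= be <= 1
  | _ => True
  end.

Definition Sig_trace0 : set 'M[R]_2 := [set s | exists u v, s = mx22 u v v (- u)].
Definition Sig_uv : set 'M[R]_2 := [set s | exists u v, s = mx22 0 u u v].
Definition Sig_diag : set 'M[R]_2 := [set s | exists u v, s = mx22 u 0 0 v].
Definition Sig_e1 : set 'M[R]_2 := [set s | exists u, s = mx22 u 0 0 0].
Definition Sig_scal : set 'M[R]_2 := [set s | exists u, s = mx22 u 0 0 u].
Definition Sig_anti : set 'M[R]_2 := [set s | exists u, s = mx22 0 u u 0].

Definition member_Sigma (m : member) : set 'M[R]_2 :=
  match m with
  | b1 | c2 _ | c3 => Sig_trace0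
  | a1 | b3 _ | b4 | b5 | c7 _ | c8 | c9 | c10 => Sig_uv
  | b6 | c12 _ => Sig_diag
  | b2 | c4 _ | c5 | c6 | d3 _ | d4 | d5 | d6 => Sig_e1
  | c1 | d1 _ | d2 => Sig_scal
  | c11 | d7 _ => Sig_anti
  end.

Definition member_H (m : member) : set 'M[R]_2 :=
  match m with
  | a1 => [set h | exists t s r, h = mx22 (expR t) r 0 (expR s)]
  | b1 | c1 => [set h | exists t x, h = expR t *: rot x]
  | b2 => [set h | exists t s r, h = mx22 (expR t) 0 r (expR s)]
  | b3 la =>
      [set h | exists t s, h = mx22 (expR (t * la)) s 0 (expR (t * (la + 1)))]
  | b4 | b6 | c5 | c11 => [set h | exists t s, h = mx22 (expR t) 0 0 (expR s)]
  | b5 => [set h | exists t s, h = mx22 (expR t) s 0 (expR t)]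
  | c2 al | d1 al => [set h | exists t, h = expR t *: rot (t * al)]
  | c3 | d2 => [set h | exists x, h = rot x]
  | c4 la =>
      [set h | exists t s, h = mx22 (expR (t * la)) 0 s (expR (t * (la + 1)))]
  | c6 => [set h | exists t s, h = mx22 (expR t) 0 s (expR t)]
  | c7 la | d3 la =>
      [set h | exists t, h = expR (t * la) *: mx22 1 0 0 (expR t)]
  | c8 => [set h | exists t, h = mx22 1 t 0 1]
  | c9 => [set h | exists t, h = expR t *: mx22 1 t 0 1]
  | c10 | d6 => [set h | exists t, h = mx22 (expR t) 0 0 (expR t)]
  | c12 be | d7 be => [set h | exists t, h = mx22 (expR t) 0 0 (expR (t * be))]
  | d4 => [set h | exists t, h = mx22 1 0 t 1]
  | d5 => [set h | exists t, h = expR t *: mx22 1 0 t 1]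
  end.

Definition member_group (m : member) : set 'M[R]_4 :=
  semidirect (member_Sigma m) (member_H m).

Definition member_dim (m : member) : nat :=
  match m with
  | a1 => 5
  | b1 | b2 | b3 _ | b4 | b5 | b6 => 4
  | c1 | c2 _ | c3 | c4 _ | c5 | c6 | c7 _ | c8 | c9 | c10 | c11 | c12 _ => 3
  | d1 _ | d2 | d3 _ | d4 | d5 | d6 | d7 _ => 2
  end.

End List.

Arguments member : clear implicits.

(* Main.v *)
(* A group H generated by the exponentials of its Lie algebra is determined by
   that Lie algebra, so the pairs (Sigma, H) can be classified as pairs
   (Sigma, V), with V a Lie subalgebra of the infinitesimal stabilizer
   {X | X^T s + s X in Sigma for all s in Sigma}. Up to congruence Sigma is
   spanned by E11, 1 or E12 + E21, or is the orthogonal complement of one of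
   these for the trace form; the stabilizer is then triangular, conformal or
   diagonal, and its subalgebras are found by hand. Conversely the type of Sigma
   is read off its dimension and the signs of its determinants, and V off the
   traces and determinants of its elements or, in the triangular case, off their
   diagonals and the membership of E21 and of the identity. *)
From HB Require Import structures.
From mathcomp Require Import all_boot all_order all_algebra.
From mathcomp Require Import all_classical all_reals all_analysis.
From mathcomp Require Import ring lra.
Require Import Defs.

Set Implicit Arguments.
Unset Strict Implicit.
Unset Printing Implicit Defensive.

Import Order.TTheory GRing.Theory Num.Theory.
Import numFieldNormedType.Exports.

Local Open Scope classical_set_scope.
Local Open Scope ring_scope.

(** * The matrix exponential *)


(** Since H need not be closed, its Lie algebra is only given as the set of X whose whole
    one-parameter group lies in H, so every link between group and algebra is drawn from curves. Two
    tools do this: uniqueness of solutions of F' = X F, and the passage between a curve in a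
    subspace and its velocity, a subspace being written as the kernel of a linear map. Rotations are
    the delicate case: the exponential is not injective there, so an angular speed has to be found
    by differentiating at 0 and not from a single exponential. The parameters come from picking a
    generator of a line. lambda results from scaling the difference of the two diagonal entries to
    1, alpha >= 0 from a reflection that reverses angles, and beta in [-1, 1] from a swap that puts
    the entry of larger modulus first. All these normalising matrices preserve Sigma, so Sigma can
    be normalised before the algebra. *)

Section FactorialSeries.
Context {R : realType}.
Implicit Types (d : nat -> R) (C D x : R).

(** With 1/k! split off, differentiating the power series term by term is just a shift of [d]. *)
Definition fact_coef d : nat -> R := fun k => (k`!%:R)^-1 * d k.

(** Geometric growth of [d] gives domination by [D] times the exponential series at [C * |x|]. *)
Lemma is_cvg_pseries_fact d D C x : (forall k, `|d k| <= D * C ^+ k) ->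
  cvgn (pseries (fact_coef d) x).
Proof.
move=> dD; have D0 : 0 <= D by have := dD 0%N; rewrite expr0 mulr1; apply: le_trans.
apply: normed_cvg.
apply: (@series_le_cvg _ _ (fun k => D * exp_coeff (C * `|x|) k)) => [k|k|k|].
- exact: normr_ge0.
- have := le_trans (normr_ge0 _) (dD k) => DC.
  by rewrite /exp_coeff/= exprMn !mulrA mulr_ge0 ?invr_ge0// mulr_ge0.
- rewrite /= /fact_coef !normrM normfV normr_nat normrX /exp_coeff/= exprMn.
  rewrite (_ : D * _ = k`!%:R^-1 * (D * C ^+ k) * `|x| ^+ k); last by ring.
  by rewrite ler_wpM2r ?exprn_ge0// ler_wpM2l ?invr_ge0.
- rewrite (_ : (fun k => _) = D *: exp_coeff (C * `|x|))//.
  by apply: is_cvg_seriesZ; exact: is_cvg_series_exp_coeff.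
Qed.

Lemma pseries_diffs_fact d :
  pseries_diffs (fact_coef d) = fact_coef (fun k => d k.+1).
Proof.
apply/funext => k; rewrite /pseries_diffs /fact_coef mulrA factS natrM invfM mulrA.
by rewrite divff ?pnatr_eq0// mul1r.
Qed.

(** The growth bound survives each shift with [D] replaced by [D * C], so the series and its first
    two formal derivatives all converge; [|x| + 1] is merely a point beyond [|x|]. *)
Lemma is_derive_pseries_fact d D C x : (forall k, `|d k| <= D * C ^+ k) ->
  is_derive x 1 (fun x => limn (pseries (fact_coef d) x))
    (limn (pseries (fact_coef (fun k => d k.+1)) x)).
Proof.
move=> dD; have dS k : `|d k.+1| <= (D * C) * C ^+ k by rewrite -mulrA -exprS.
have dSS k : `|d k.+2| <= (D * C * C) * C ^+ k by rewrite -mulrA -exprS.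
rewrite -pseries_diffs_fact.
apply: (@pseries_snd_diffs _ _ (`|x| + 1)); rewrite ?pseries_diffs_fact.
- exact: is_cvg_pseries_fact dD.
- exact: is_cvg_pseries_fact dS.
- exact: is_cvg_pseries_fact dSS.
- by rewrite [ltRHS]ger0_norm ?addr_ge0// ltrDl.
Qed.

End FactorialSeries.

Section MatrixExponential.
Context {R : realType} {n : nat}.
Implicit Types (X Y g : 'M[R]_n) (F : R -> 'M[R]_n).

Lemma cvg_mx_entries (u : nat -> 'M[R]_n) X :
  (forall i j, (fun k => u k i j) @ \oo --> X i j) -> u @ \oo --> X.
Proof.
move=> uX A [P XP PA].
have /filter_forall : forall i, \forall k \near \oo, forall j, P i j (u k i j).
  by move=> i; apply: filter_forall => j; apply: uX; exact: XP.
by apply: filterS => k PN; apply: PA.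
Qed.

(** The sum of all absolute entries dominates every row sum. The factor 1 keeps the shape
    [D * C ^+ k] of the series lemmas. *)
Lemma norm_expr_entry X i j k :
  `|(X ^+ k) i j| <= 1 * (\sum_a \sum_b `|X a b|) ^+ k.
Proof.
rewrite mul1r; set C := \sum_a _.
elim: k i j => [|k IH] i j.
  by rewrite !expr0 mxE; case: eqP => _; rewrite ?normr1 ?normr0.
rewrite !exprS mxE (le_trans (ler_norm_sum _ _ _))//.
under eq_bigr do rewrite normrM.
apply: (@le_trans _ _ (\sum_b `|X i b| * C ^+ k)).
  by apply: ler_sum => b _; rewrite ler_wpM2l.
rewrite -mulr_suml ler_wpM2r ?exprn_ge0//.
  by rewrite sumr_ge0// => a _; rewrite sumr_ge0.
by rewrite /C [leRHS](bigD1 i)//= lerDl sumr_ge0// => a _; rewrite sumr_ge0.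
Qed.

Lemma expmx_entry X t i j :
  expmx (t *: X) i j = limn (pseries (fact_coef (fun k => (X ^+ k) i j)) t).
Proof.
rewrite /expmx.
suff /cvg_lim -> : series (fun k => (k`!%:R)^-1 *: (t *: X) ^+ k) @ \oo -->
   (\matrix_(i, j) limn (pseries (fact_coef (fun k => (X ^+ k) i j)) t) : 'M[R]_n).
- by rewrite mxE.
- exact: norm_hausdorff.
apply: cvg_mx_entries => a b; rewrite mxE.
rewrite (_ : (fun k => _) = pseries (fact_coef (fun k => (X ^+ k) a b)) t).
  by apply: is_cvg_pseries_fact => k; exact: norm_expr_entry.
apply/funext => N; rewrite /pseries /series/= summxE; apply: eq_bigr => k _.
rewrite mxE /fact_coef -mulrA [_ * t ^+ k]mulrC; congr (_ * _).
elim: k a b => [|k IH] a b; first by rewrite !expr0 mul1r.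
rewrite !exprS !mxE mulr_sumr; apply: eq_bigr => l _.
by rewrite mxE IH; ring.
Qed.


End MatrixExponential.

(** * Entrywise derivatives of matrix-valued curves *)

Section MatrixDerivative.
Context {R : realType}.

(** Entrywise, so that the scalar rules apply directly, and rectangular, so that it covers
    blocks. *)
Definition mx_deriv {m n} (F : R -> 'M[R]_(m, n)) (t : R) (D : 'M[R]_(m, n)) :=
  forall i j, is_derive t 1 (fun x => F x i j) (D i j).

Lemma mx_deriv_eq m n (F G : R -> 'M[R]_(m, n)) t D D' :
  mx_deriv F t D -> F =1 G -> D = D' -> mx_deriv G t D'.
Proof. by move=> + /funext <- <-. Qed.

Lemma mx_deriv_unique m n (F : R -> 'M[R]_(m, n)) t D D' :
  mx_deriv F t D -> mx_deriv F t D' -> D = D'.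
Proof.
move=> FD FD'; apply/matrixP => i j.
by have [_ <-] := FD i j; have [_ <-] := FD' i j.
Qed.

Lemma mx_deriv_cst m n (A : 'M[R]_(m, n)) t : mx_deriv (fun=> A) t 0.
Proof. by move=> i j; rewrite mxE; exact: is_derive_cst. Qed.

Lemma mx_derivM m n p (F : R -> 'M[R]_(m, n)) (G : R -> 'M[R]_(n, p)) t D E :
  mx_deriv F t D -> mx_deriv G t E ->
  mx_deriv (fun x => F x *m G x) t (D *m G t + F t *m E).
Proof.
move=> FD GE i j.
rewrite (_ : (fun x => _) = \sum_l ((fun x => F x i l) * (fun x => G x l j)));
  last by apply/funext => x; rewrite mxE fct_sumE.
apply: is_derive_eq.
  by apply: is_derive_sum => l; apply: is_deriveM; [exact: FD | exact: GE].
rewrite !mxE -big_split/=; apply: eq_bigr => l _.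
by rewrite addrC; congr (_ + _); exact: mulrC.
Qed.

Lemma mx_derivMl m n p (A : 'M[R]_(m, n)) (G : R -> 'M[R]_(n, p)) t E :
  mx_deriv G t E -> mx_deriv (fun x => A *m G x) t (A *m E).
Proof.
move=> GE; apply: mx_deriv_eq (mx_derivM (mx_deriv_cst A t) GE) _ _ => //.
by rewrite mul0mx add0r.
Qed.

Lemma mx_derivMr m n p (F : R -> 'M[R]_(m, n)) (A : 'M[R]_(n, p)) t D :
  mx_deriv F t D -> mx_deriv (fun x => F x *m A) t (D *m A).
Proof.
move=> FD; apply: mx_deriv_eq (mx_derivM FD (mx_deriv_cst A t)) _ _ => //.
by rewrite mulmx0 addr0.
Qed.

Lemma mx_derivT m n (F : R -> 'M[R]_(m, n)) t D :
  mx_deriv F t D -> mx_deriv (fun x => (F x)^T) t D^T.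
Proof.
move=> FD i j; rewrite mxE; have := FD j i.
by under [X in _ -> is_derive _ _ X _]eq_fun do rewrite mxE.
Qed.

Lemma mx_deriv_comp m n (F : R -> 'M[R]_(m, n)) (c t : R) D :
  mx_deriv F (c * t) D -> mx_deriv (fun x => F (c * x)) t (c *: D).
Proof.
move=> FD i j; rewrite mxE mulrC.
apply: (@is_derive1_comp _ (fun x => F x i j) (fun x => c * x)) => //.
have := is_deriveZ c (is_derive_id t (1 : R)).
by rewrite /GRing.scale/= mulr1.
Qed.

Lemma mx_deriv_mxsub m n p q (f : 'I_p -> 'I_m) (g : 'I_q -> 'I_n)
    (F : R -> 'M[R]_(m, n)) t D :
  mx_deriv F t D -> mx_deriv (fun x => mxsub f g (F x)) t (mxsub f g D).
Proof.
move=> FD i j; rewrite mxE.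
by under [X in is_derive _ _ X _]eq_fun do rewrite mxE.
Qed.

Lemma mx_deriv_linear m n p q (f : {linear 'M[R]_(m, n) -> 'M[R]_(p, q)})
    (F : R -> 'M[R]_(m, n)) t D :
  mx_deriv F t D -> mx_deriv (fun x => f (F x)) t (f D).
Proof.
move=> FD i j.
have fE M : f M i j = \sum_a \sum_b f (delta_mx a b) i j * M a b.
  rewrite {1}[M]matrix_sum_delta linear_sum summxE; apply: eq_bigr => a _.
  rewrite linear_sum summxE; apply: eq_bigr => b _.
  by rewrite linearZ mxE mulrC.
rewrite fE (_ : (fun x => _) =
  \sum_a \sum_b (f (delta_mx a b) i j \*: (fun x => F x a b))); last first.
  apply/funext => x; rewrite fE fct_sumE; apply: eq_bigr => a _.
  by rewrite fct_sumE.
by apply: is_derive_sum => a; apply: is_derive_sum => b; apply: is_deriveZ; exact: FD.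
Qed.

Lemma mx_deriv0_cst m n (F : R -> 'M[R]_(m, n)) :
  (forall t, mx_deriv F t 0) -> forall t, F t = F 0.
Proof.
move=> F0 t; apply/matrixP => i j.
apply: (@is_derive_0_is_cst _ (fun x => F x i j)) => x.
by have := F0 x i j; rewrite mxE.
Qed.

(** Membership becomes a linear equation, which can be differentiated; the map is the complement of
    the projection on [V]. *)
Lemma lker_vspace m n (V : {vspace 'M[R]_(m, n)}) :
  exists f : {linear 'M[R]_(m, n) -> 'M[R]_(m, n)}, forall X, (X \in V) = (f X == 0).
Proof.
exists (\1 - projv V)%VF => X.
change ((X \in V) = ((\1 - projv V)%VF X == 0)).
rewrite add_lfunE opp_lfunE id_lfunE subr_eq0.
apply/idP/eqP => [XV|->]; first by rewrite projv_id.
exact: memv_proj.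
Qed.

(** The linear equation of [V] is constantly 0 along [F], so it kills the derivative as well. *)
Lemma mx_deriv_mem m n (V : {vspace 'M[R]_(m, n)}) (F : R -> 'M[R]_(m, n)) t D :
  mx_deriv F t D -> (forall x, F x \in V) -> D \in V.
Proof.
have [f fV] := lker_vspace V; move=> FD FV; rewrite fV; apply/eqP.
apply: mx_deriv_unique (mx_deriv_linear f FD) _.
apply: mx_deriv_eq (mx_deriv_cst 0 t) _ _ => // x.
by apply/esym/eqP; rewrite -fV.
Qed.

(** The integrated counterpart: the linear equation of [V] along [F] has zero derivative and starts
    at 0. *)
Lemma mem_mx_deriv m n (V : {vspace 'M[R]_(m, n)}) (F D : R -> 'M[R]_(m, n)) :
  (forall t, mx_deriv F t (D t)) -> (forall t, D t \in V) -> F 0 \in V ->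
  forall t, F t \in V.
Proof.
have [f fV] := lker_vspace V; move=> FD DV; rewrite fV => /eqP F0 t; rewrite fV.
rewrite (@mx_deriv0_cst _ _ (fun x => f (F x))) ?F0// => x.
apply: mx_deriv_eq (mx_deriv_linear f (FD x)) _ _ => //.
by apply/eqP; rewrite -fV.
Qed.

End MatrixDerivative.

(** * The exponential as the solution of a linear differential equation *)

Section ExponentialODE.
Context {R : realType} {n : nat}.
Implicit Types (X Y Z g : 'M[R]_n) (F : R -> 'M[R]_n).

(** Pulls fixed factors out of the series; [Y = X] or [Z = X] identifies the shifted series that
    differentiation produces. *)
Lemma expmx_entryM X Y Z t i j (d := fun k => (Y *m X ^+ k *m Z) i j) :
  limn (pseries (fact_coef d) t) = (Y *m expmx (t *: X) *m Z) i j.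
Proof.
apply: cvg_lim => //; rewrite mxE.
rewrite (_ : pseries (fact_coef d) t = (fun N => \sum_b \sum_a Z b j * Y i a *
   pseries (fact_coef (fun k => (X ^+ k) a b)) t N)); last first.
  apply/funext => N; rewrite /pseries/= /series/=.
  under [RHS]eq_bigr do under eq_bigr do rewrite mulr_sumr.
  under [RHS]eq_bigr do rewrite exchange_big/=.
  rewrite exchange_big/=; apply: eq_bigr => k _.
  rewrite /fact_coef /d mxE mulr_sumr mulr_suml; apply: eq_bigr => b _.
  rewrite mxE mulr_suml mulr_sumr mulr_suml; apply: eq_bigr => a _.
  by ring.
rewrite (_ : \sum_b _ = \sum_b \sum_a (Z b j * Y i a * expmx (t *: X) a b)).
  apply: cvg_big => [|b _]; first exact: add_continuous.
  apply: cvg_big => [|a _]; first exact: add_continuous.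
  apply: cvgMr; rewrite expmx_entry; apply: is_cvg_pseries_fact => k; exact: norm_expr_entry.
apply: eq_bigr => b _; rewrite mxE mulr_suml; apply: eq_bigr => a _.
by ring.
Qed.

Lemma mx_deriv_expmxl X t :
  mx_deriv (fun t => expmx (t *: X)) t (X *m expmx (t *: X)).
Proof.
move=> i j; have := is_derive_pseries_fact t (norm_expr_entry X i j).
under eq_fun do rewrite -expmx_entry.
congr is_derive; under eq_fun do rewrite exprS.
have := expmx_entryM X X 1%:M t i j; rewrite mulmx1 => <-.
by congr (limn (pseries (fact_coef _) t)); apply/funext => k; rewrite mulmx1.
Qed.

(** Having [X] on either side lets terms cancel in the product rule without a separate commutation
    argument. *)
Lemma mx_deriv_expmxr X t :
  mx_deriv (fun t => expmx (t *: X)) t (expmx (t *: X) *m X).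
Proof.
move=> i j; have := is_derive_pseries_fact t (norm_expr_entry X i j).
under eq_fun do rewrite -expmx_entry.
congr is_derive; under eq_fun do rewrite exprSr.
have := expmx_entryM X 1%:M X t i j; rewrite mul1mx => <-.
by congr (limn (pseries (fact_coef _) t)); apply/funext => k; rewrite mul1mx.
Qed.

Lemma expmx0 : expmx (0 : 'M[R]_n) = 1%:M.
Proof.
apply/matrixP => i j; rewrite -[0](scale0r (0 : 'M[R]_n)) expmx_entry.
(* The empty partial sum is 0; from index 1 on the sequence is constant. *)
apply: cvg_lim => //; rewrite -cvg_shiftS.
rewrite (_ : (fun _ => _) = cst ((1%:M : 'M[R]_n) i j)); first exact: cvg_cst.
apply/funext => N; rewrite /pseries/series/= big_nat_recl//= big1 ?addr0.
  by rewrite /fact_coef fact0 invr1 mul1r mulr1.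
by move=> k _; rewrite expr0n mulr0.
Qed.

Lemma expmxNl X t : expmx (- t *: X) *m expmx (t *: X) = 1%:M.
Proof.
rewrite (@mx_deriv0_cst _ _ _ (fun t => expmx (- t *: X) *m expmx (t *: X))).
  by rewrite oppr0 scale0r expmx0 mulmx1.
move=> u; have D1 := mx_deriv_expmxr X (-1 * u).
have := mx_derivM (mx_deriv_comp D1) (mx_deriv_expmxl X u).
move/mx_deriv_eq; apply => [x|]; first by rewrite mulN1r.
by rewrite scaleN1r mulN1r mulNmx mulmxA addNr.
Qed.

Lemma expmxN X : expmx (- X) *m expmx X = 1%:M.
Proof. by have := expmxNl X 1; rewrite scaleN1r scale1r. Qed.

Lemma expmx_unit X : expmx X \in unitmx.
Proof. by have /mulmx1_unit[] := expmxN X. Qed.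

Lemma invmx_expmx X : invmx (expmx X) = expmx (- X).
Proof. by rewrite -[LHS]mul1mx -(expmxN X) mulmxK ?expmx_unit. Qed.

(** Uniqueness: the curve [expmx (- t *: X) *m F t] has zero derivative. *)
Lemma mx_ode p X (F : R -> 'M[R]_(n, p)) : (forall t, mx_deriv F t (X *m F t)) ->
  forall t, F t = expmx (t *: X) *m F 0.
Proof.
move=> FD t; apply: (can_inj (mulKmx (expmx_unit (- t *: X)))).
rewrite mulmxA expmxNl mul1mx.
rewrite (@mx_deriv0_cst _ _ _ (fun t => expmx (- t *: X) *m F t)).
  by rewrite oppr0 scale0r expmx0 mul1mx.
move=> u; have D1 := mx_deriv_expmxr X (-1 * u).
have := mx_derivM (mx_deriv_comp D1) (FD u).
move/mx_deriv_eq; apply => [x|]; first by rewrite mulN1r.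
by rewrite scaleN1r mulN1r mulNmx mulmxA addNr.
Qed.

Lemma expmx_ode X F : (forall t, mx_deriv F t (X *m F t)) -> F 0 = 1%:M ->
  forall t, F t = expmx (t *: X).
Proof. by move=> /mx_ode FE F0 t; rewrite FE F0 mulmx1. Qed.

Lemma mx_deriv_expmx0 X : mx_deriv (fun t => expmx (t *: X)) 0 X.
Proof.
have := mx_deriv_expmxl X 0.
by move/mx_deriv_eq; apply => //; rewrite scale0r expmx0 mulmx1.
Qed.

Lemma expmx_inj X Y : (forall t, expmx (t *: X) = expmx (t *: Y)) -> X = Y.
Proof.
move=> XY; apply: mx_deriv_unique (mx_deriv_expmx0 X) _.
by have := mx_deriv_expmx0 Y; move/mx_deriv_eq; apply => // t; rewrite XY.
Qed.

Lemma expmx_conj g X : g \in unitmx ->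
  expmx (g *m X *m invmx g) = g *m expmx X *m invmx g.
Proof.
move=> gu; pose F t := g *m expmx (t *: X) *m invmx g.
suff /(_ 1) : forall t, F t = expmx (t *: (g *m X *m invmx g)).
  by rewrite /F !scale1r.
apply: expmx_ode => [t|].
  have := mx_derivMr (invmx g) (mx_derivMl g (mx_deriv_expmxl X t)).
  by move/mx_deriv_eq; apply => //; rewrite /F !mulmxA mulmxKV.
by rewrite /F scale0r expmx0 mulmx1 mulmxV.
Qed.

Lemma expmx_tr X : expmx X^T = (expmx X)^T.
Proof.
pose F t := (expmx (t *: X))^T.
suff /(_ 1) : forall t, F t = expmx (t *: X^T) by rewrite /F !scale1r.
apply: expmx_ode => [t|].
  have := mx_derivT (mx_deriv_expmxr X t).
  by move/mx_deriv_eq; apply => //; rewrite trmx_mul.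
by rewrite /F scale0r expmx0 trmx1.
Qed.

End ExponentialODE.

(** * Exponentials of 2x2 matrices *)


Section Matrices22.
Context {R : realType}.
Implicit Types (X Y g h : 'M[R]_2) (a b c d : R).

Lemma mx22_eta X : X = mx22 (X 0 0) (X 0 1) (X 1 0) (X 1 1).
Proof.
by apply/matrixP => -[[|[|//]] ?] [[|[|//]] ?]; rewrite mxE/=; congr (X _ _); apply: val_inj.
Qed.

Lemma mx22_inj a b c d a' b' c' d' : mx22 a b c d = mx22 a' b' c' d' ->
  [/\ a = a', b = b', c = c' & d = d'].
Proof.
move/matrixP => E.
by split; [move: (E 0 0)|move: (E 0 1)|move: (E 1 0)|move: (E 1 1)]; rewrite !mxE.
Qed.

Lemma mx22M a b c d a' b' c' d' : mx22 a b c d *m mx22 a' b' c' d' =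
  mx22 (a * a' + b * c') (a * b' + b * d') (c * a' + d * c') (c * b' + d * d').
Proof.
rewrite [LHS]mx22_eta; congr mx22; rewrite !mxE !big_ord_recl big_ord0 !mxE/= addr0//.
Qed.

Lemma mx22D a b c d a' b' c' d' :
  mx22 a b c d + mx22 a' b' c' d' = mx22 (a + a') (b + b') (c + c') (d + d').
Proof. by rewrite [LHS]mx22_eta; congr mx22; rewrite !mxE. Qed.

Lemma mx22N a b c d : - mx22 a b c d = mx22 (- a) (- b) (- c) (- d).
Proof. by rewrite [LHS]mx22_eta; congr mx22; rewrite !mxE. Qed.

Lemma mx22Z k a b c d : k *: mx22 a b c d = mx22 (k * a) (k * b) (k * c) (k * d).
Proof. by rewrite [LHS]mx22_eta; congr mx22; rewrite !mxE. Qed.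

Lemma mx22T a b c d : (mx22 a b c d)^T = mx22 a c b d.
Proof. by rewrite [LHS]mx22_eta; congr mx22; rewrite !mxE. Qed.

Lemma mx22_0 : (0 : 'M[R]_2) = mx22 0 0 0 0.
Proof. by rewrite [LHS]mx22_eta; congr mx22; rewrite !mxE. Qed.

Lemma mx22_1 : (1%:M : 'M[R]_2) = mx22 1 0 0 1.
Proof. by rewrite [LHS]mx22_eta; congr mx22; rewrite !mxE. Qed.

Lemma det_mx22 a b c d : \det (mx22 a b c d) = a * d - b * c.
Proof.
rewrite (expand_det_row _ 0) !big_ord_recl big_ord0 /cofactor !det_mx11 !mxE/=.
by rewrite expr0 mul1r expr1 addr0 mulN1r mulrN.
Qed.

Lemma tr_mx22 a b c d : \tr (mx22 a b c d) = a + d.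
Proof. by rewrite /mxtrace !big_ord_recl big_ord0 !mxE/= addr0. Qed.

Lemma mx22_unit a b c d : (mx22 a b c d \in unitmx) = (a * d - b * c != 0).
Proof. by rewrite unitmxE det_mx22 unitfE. Qed.

Lemma invmx_eq n (A B : 'M[R]_n) : A *m B = 1%:M -> invmx A = B.
Proof.
move=> AB; have [Au _] := mulmx1_unit AB.
by rewrite -[RHS](mulKmx Au) AB mulmx1.
Qed.

Definition mx22E := (mx22M, mx22D, mx22N, mx22Z, mx22T).

Lemma mx_deriv_mx22 (f1 f2 f3 f4 : R -> R) (d1 d2 d3 d4 t : R) :
  is_derive t 1 f1 d1 -> is_derive t 1 f2 d2 -> is_derive t 1 f3 d3 ->
  is_derive t 1 f4 d4 ->
  mx_deriv (fun x => mx22 (f1 x) (f2 x) (f3 x) (f4 x)) t (mx22 d1 d2 d3 d4).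
Proof.
move=> ? ? ? ? i j; rewrite mxE.
under [X in is_derive _ _ X _]eq_fun do rewrite mxE.
by do 2 case: ifP => _.
Qed.

End Matrices22.

Section Exponentials22.
Context {R : realType}.
Implicit Types (X Y g h : 'M[R]_2) (a b c d t : R).

Lemma is_derive_mulr a t : is_derive t 1 ( *%R^~ a) a.
Proof.
have := is_deriveZ a (is_derive_id t (1 : R)).
rewrite /GRing.scale/= mulr1; congr is_derive; apply/funext => x.
exact: mulrC.
Qed.

Lemma is_derive_exp_mul a t :
  is_derive t 1 (fun x => expR (x * a)) (a * expR (t * a)).
Proof.
have := @is_derive1_comp _ expR ( *%R^~ a) t _ _ (is_derive_expR (t * a)) (is_derive_mulr a t).
by rewrite mulrC.
Qed.

Lemma is_derive_sin_mul a t :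
  is_derive t 1 (fun x => sin (x * a)) (a * cos (t * a)).
Proof.
have := @is_derive1_comp _ sin ( *%R^~ a) t _ _ (is_derive_sin (t * a)) (is_derive_mulr a t).
by rewrite mulrC.
Qed.

Lemma is_derive_cos_mul a t :
  is_derive t 1 (fun x => cos (x * a)) (- (a * sin (t * a))).
Proof.
have := @is_derive1_comp _ cos ( *%R^~ a) t _ _ (is_derive_cos (t * a)) (is_derive_mulr a t).
by rewrite mulNr mulrC.
Qed.

(** The divided difference of the exponential, extended by the derivative on the diagonal; it
    multiplies the corner entry of a triangular exponential. *)
Definition expR_slope a b := if a == b then expR a else (expR b - expR a) / (b - a).

Lemma expR_slope_neq0 a b : expR_slope a b != 0.
Proof.
rewrite /expR_slope; case: (eqVneq a b) => [_|ab]; first by rewrite gt_eqF ?expR_gt0.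
by rewrite mulf_neq0 ?invr_eq0 ?subr_eq0 1?eq_sym// (inj_eq (@expR_inj _)).
Qed.

Lemma expmx_lower a c b :
  expmx (mx22 a 0 c b) = mx22 (expR a) 0 (c * expR_slope a b) (expR b).
Proof.
(* [s] solves s' = b s + e^(ta) with s(0) = 0, the equation satisfied by the corner entry when c =
   1. *)
pose s t := if a == b then t * expR (t * a) else (expR (t * b) - expR (t * a)) / (b - a).
pose F t := mx22 (expR (t * a)) 0 (c * s t) (expR (t * b)).
have sD t : is_derive t 1 s (expR (t * a) + b * s t).
  rewrite /s; case: eqVneq => [<-|ab].
    have := is_deriveM (is_derive_id t (1 : R)) (is_derive_exp_mul a t).
    by move/is_derive_eq; apply; rewrite /GRing.scale/=; ring.
  have := is_deriveZ (b - a)^-1 (is_deriveB (is_derive_exp_mul b t) (is_derive_exp_mul a t)).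
  rewrite (_ : _ \*: _ = (fun t => (expR (t * b) - expR (t * a)) / (b - a))).
    move/is_derive_eq; apply; rewrite /GRing.scale/=; field.
    by rewrite subr_eq0 eq_sym.
  by apply/funext => x; exact: mulrC.
have /(_ 1) : forall t, F t = expmx (t *: mx22 a 0 c b).
  apply: expmx_ode => [t|]; last first.
    rewrite /F mx22_1 /s !mul0r expR0; case: eqP => _; first by rewrite mulr0.
    by rewrite subrr mul0r mulr0.
  have := mx_deriv_mx22 (is_derive_exp_mul a t) (is_derive_cst (0 : R) t (1 : R))
    (is_deriveZ c (sD t)) (is_derive_exp_mul b t).
  move/mx_deriv_eq; apply => //.
  by rewrite /F mx22E /GRing.scale/=; congr mx22; ring.
by rewrite scale1r => <-; rewrite /F /s /expR_slope !mul1r.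
Qed.

Lemma expmx_diag a b : expmx (mx22 a 0 0 b) = mx22 (expR a) 0 0 (expR b).
Proof. by rewrite expmx_lower mul0r. Qed.

Lemma expmx_conformal a b : expmx (mx22 a (- b) b a) = expR a *: rot b.
Proof.
pose F t := expR (t * a) *: rot (t * b).
have /(_ 1) : forall t, F t = expmx (t *: mx22 a (- b) b a).
  apply: expmx_ode => [t|]; last first.
    by rewrite /F !mul0r expR0 scale1r /rot cos0 sin0 oppr0 mx22_1.
  have EC := is_deriveM (is_derive_exp_mul a t) (is_derive_cos_mul b t).
  have ES := is_deriveM (is_derive_exp_mul a t) (is_derive_sin_mul b t).
  have := mx_deriv_mx22 EC (is_deriveN ES) ES EC.
  move/mx_deriv_eq; apply => [x|]; rewrite /F /rot mx22E.
    by congr mx22; rewrite mulrN.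
  by rewrite mx22E /GRing.scale/=; congr mx22; ring.
by rewrite /F scale1r !mul1r.
Qed.

End Exponentials22.

(** * Subgroups generated by exponentials *)


Section LieSubgroups.
Context {R : realType} {n : nat}.
Implicit Types (X Y g : 'M[R]_n) (G H : set 'M[R]_n).

(** The part of connectedness that makes a group recoverable from its Lie algebra; it passes through
    conjugation and transposition. *)
Definition exp_generated G : Prop := subgroup_GL G /\
  forall g, G g -> exists2 s : seq 'M[R]_n,
    (forall X, X \in s -> lie_algebra G X) & g = \prod_(X <- s) expmx X.

Lemma lie_algebra_expmx G X : lie_algebra G X -> G (expmx X).
Proof. by move/(_ 1); rewrite scale1r. Qed.

Lemma exp_generated_eq G H : exp_generated G -> exp_generated H ->
  lie_algebra G = lie_algebra H -> G = H.
Proof.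
suff sub G1 G2 : exp_generated G1 -> exp_generated G2 ->
    lie_algebra G1 = lie_algebra G2 -> G1 `<=` G2.
  by move=> eG eH GH; apply/seteqP; split; apply: sub.
move=> [_ genG] [[_ H1 HM _] _] GH g /genG[s sG ->].
elim: s sG => [|X s IH] sG; first by rewrite big_nil.
rewrite big_cons; apply: HM.
  by apply: lie_algebra_expmx; rewrite -GH; apply: sG; rewrite mem_head.
by apply: IH => Y Ys; apply: sG; rewrite inE Ys orbT.
Qed.

(** The entry is identically zero along the one-parameter group of [X], and its derivative at 0 is
    the entry of [X]. *)
Lemma lie_algebra_entry0 G X i j : (forall g, G g -> g i j = 0) ->
  lie_algebra G X -> X i j = 0.
Proof.
move=> G0 GX; have [_ <-] := mx_deriv_expmx0 X i j.
by under eq_fun do rewrite (G0 _ (GX _)); rewrite derive_cst.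
Qed.

(** Lets the lower triangular results serve for upper triangular groups. *)
Definition trset G : set 'M[R]_n := [set g | G g^T].

Lemma trsetK G : trset (trset G) = G.
Proof. by apply/seteqP; split=> g; rewrite /trset/= trmxK. Qed.

Lemma lie_algebra_trset G : lie_algebra (trset G) = trset (lie_algebra G).
Proof.
by apply/seteqP; split=> X /= GX t; have := GX t; rewrite /trset/= -?expmx_tr linearZ.
Qed.

Lemma exp_generated_trset G : exp_generated G -> exp_generated (trset G).
Proof.
move=> [[GL_ G1 GM GV] gen]; split.
  split=> [g||g h|g].
  - by move/GL_; rewrite /GL/= unitmx_tr.
  - by rewrite /trset/= trmx1.
  - by rewrite /trset/= trmx_mul => ? ?; apply: GM.
  - by rewrite /trset/= trmx_inv; exact: GV.
(* Transposition reverses products, hence the reversed list of factors. *)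
move=> g /= /gen[s sG gE]; exists (rev (map trmx s)).
  move=> X; rewrite mem_rev => /mapP[Y /sG sY ->].
  by rewrite lie_algebra_trset /trset/= trmxK.
rewrite -[g]trmxK gE; elim: s {sG gE} => [|X s IH].
  by rewrite !big_nil trmx1.
by rewrite map_cons rev_cons big_rcons/= big_cons trmx_mul IH expmx_tr.
Qed.

Lemma subgroup_conj_set g G : g \in unitmx -> subgroup_GL G ->
  subgroup_GL (conj_set g G).
Proof.
move=> gu [GL_ G1 GM GV]; split.
- move=> _ [h /GL_ hu <-]; rewrite /GL/= in hu *.
  by rewrite !unitmx_mul gu hu unitmx_inv.
- by exists 1%:M => //; rewrite mulmx1 mulmxV.
- move=> _ _ [h Gh <-] [k Gk <-]; exists (h *m k); first exact: GM.
  by rewrite !mulmxA mulmxKV.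
- move=> _ [h Gh <-]; exists (invmx h); first exact: GV.
  have hu := GL_ _ Gh; rewrite /GL/= in hu.
  apply/esym/invmx_eq.
  by rewrite !mulmxA mulmxKV// -[g *m h *m _]mulmxA mulmxV// mulmx1 mulmxV.
Qed.

Lemma lie_algebra_conj g G : g \in unitmx ->
  lie_algebra (conj_set g G) = conj_set g (lie_algebra G).
Proof.
move=> gu; apply/seteqP; split=> X.
  move=> GX; exists (invmx g *m X *m g); last by rewrite !mulmxA mulmxV// mul1mx mulmxK.
  move=> t; have [h Gh hE] := GX t.
  suff -> : expmx (t *: (invmx g *m X *m g)) = h by [].
  rewrite scalemxAl scalemxAr -[X in _ *m _ *m X]invmxK expmx_conj ?unitmx_inv// -hE.
  by rewrite invmxK !mulmxA mulVmx// mul1mx mulmxKV.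
move=> [Y GY <-] t; exists (expmx (t *: Y)) => //.
by rewrite -expmx_conj// -scalemxAr -scalemxAl.
Qed.

Lemma exp_generated_conj g G : g \in unitmx -> exp_generated G ->
  exp_generated (conj_set g G).
Proof.
move=> gu [sG gen]; split; first exact: subgroup_conj_set.
move=> _ [h /gen[s sL ->] <-]; exists [seq g *m X *m invmx g | X <- s].
  by rewrite lie_algebra_conj// => _ /mapP[X Xs ->]; exists X => //; exact: sL.
elim: s {sL} => [|X s IH]; first by rewrite !big_nil mulmx1 mulmxV.
rewrite big_cons/= !big_cons -IH expmx_conj//; set P := \prod_(_ <- _) _.
rewrite -[RHS]/(_ *m (_ *m _ *m _)) -[expmx X * P]/(expmx X *m P).
by rewrite !mulmxA mulmxKV.
Qed.

End LieSubgroups.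


(** * Triangular, diagonal, unipotent-type and conformal families *)

Section Families.
Context {R : realType}.
Implicit Types (W : R -> R -> Prop) (X Y g h : 'M[R]_2) (a b c u v t : R).

Definition plane : R -> R -> Prop := fun _ _ => True.
Definition line u v : R -> R -> Prop :=
  fun a b => exists t, a = t * u /\ b = t * v.

Definition linear_rel W := [/\ W 0 0,
  forall a b c d, W a b -> W c d -> W (a + c) (b + d)
  & forall t a b, W a b -> W (t * a) (t * b)].

Lemma plane_linear : linear_rel plane.
Proof. by []. Qed.

Lemma line_linear u v : linear_rel (line u v).
Proof.
split; first by exists 0; rewrite !mul0r.
- by move=> _ _ _ _ [s [-> ->]] [t [-> ->]]; exists (s + t); rewrite !mulrDl.
- by move=> t _ _ [s [-> ->]]; exists (t * s); rewrite !mulrA.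
Qed.

Lemma linear_relN W a b : linear_rel W -> W a b -> W (- a) (- b).
Proof. by move=> [_ _ WZ] /(WZ (-1)); rewrite !mulN1r. Qed.

(* W relates the two diagonal exponents, or for confG the logarithm of the
   modulus and the angle. *)
Definition lowG W : set 'M[R]_2 :=
  [set h | exists a b c, W a b /\ h = mx22 (expR a) 0 c (expR b)].
Definition lowL W : set 'M[R]_2 := [set X | exists a b c, W a b /\ X = mx22 a 0 c b].
Definition diagG W : set 'M[R]_2 :=
  [set h | exists a b, W a b /\ h = mx22 (expR a) 0 0 (expR b)].
Definition diagL W : set 'M[R]_2 := [set X | exists a b, W a b /\ X = mx22 a 0 0 b].
(** The one-parameter group of a Jordan block: here the corner is tied to the diagonal, so this is
    none of the [lowG W]. *)
Definition unipG : set 'M[R]_2 := [set h | exists t, h = expR t *: mx22 1 0 t 1].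
Definition unipL : set 'M[R]_2 := [set X | exists t, X = mx22 t 0 t t].
Definition confG W : set 'M[R]_2 :=
  [set h | exists a b, W a b /\ h = expR a *: rot b].
Definition confL W : set 'M[R]_2 := [set X | exists a b, W a b /\ X = mx22 a (- b) b a].

Lemma expR_mulN a : expR a * expR (- a) = 1.
Proof. by rewrite -expRD subrr expR0. Qed.

Lemma det_expR_rot a b : \det (expR a *: rot b) = expR (a + a).
Proof.
rewrite /rot mx22E det_mx22 expRD; have := cos2Dsin2 b.
by move=> E; rewrite -[RHS]mulr1 -E; ring.
Qed.

Lemma rotM a b : rot a *m rot b = rot (a + b).
Proof. by rewrite /rot mx22E sinD cosD; congr mx22; ring. Qed.

(** Once the upper entry is known to vanish, the real exponential is injective on the diagonal, so
    time 1 alone returns the relation [W]. *)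
Lemma lie_algebra_lowG W : linear_rel W -> lie_algebra (lowG W) = lowL W.
Proof.
move=> [_ _ WZ]; apply/seteqP; split=> X.
  move=> GX; have X01 : X 0 1 = 0.
    by apply: lie_algebra_entry0 GX => _ [a [b [c [_ ->]]]]; rewrite mxE.
  have [a [b [c [Wab]]]] := lie_algebra_expmx GX.
  rewrite [X in expmx X]mx22_eta X01 expmx_lower => /mx22_inj[/expR_inj Xa _ _ /expR_inj Xb].
  by exists a, b, (X 1 0); rewrite [X in X = _]mx22_eta X01 Xa Xb.
move=> [a [b [c [Wab ->]]]] t; rewrite mx22E mulr0 expmx_lower.
by eexists _, _, _; split; last by []; exact: WZ.
Qed.

Lemma exp_generated_lowG W : linear_rel W -> exp_generated (lowG W).
Proof.
move=> WL; have [W0 WD WZ] := WL; split; first split.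
- by move=> _ [a [b [c [_ ->]]]]; rewrite /GL/= mx22_unit mul0r subr0 -expRD gt_eqF ?expR_gt0.
- by exists 0, 0, 0; rewrite expR0 mx22_1.
- move=> _ _ [a [b [c [Wab ->]]]] [a' [b' [c' [Wab' ->]]]].
  exists (a + a'), (b + b'), (c * expR a' + expR b * c'); split; first exact: WD.
  by rewrite mx22E !expRD; congr mx22; ring.
- move=> _ [a [b [c [Wab ->]]]]; exists (- a), (- b), (- c * expR (- a) * expR (- b)).
  split; first exact: linear_relN.
  apply: invmx_eq; rewrite mx22E mx22_1; congr mx22; rewrite ?expR_mulN; try ring.
  rewrite (_ : c * _ + _ = c * expR (- a) * (1 - expR b * expR (- b))); last by ring.
  by rewrite expR_mulN subrr mulr0.
move=> _ [a [b [c [Wab ->]]]].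
(* Diagonal factor times unipotent factor; [expR (- b)] undoes the scaling of the second row by
   [expR b]. *)
exists [:: mx22 a 0 0 b; mx22 0 0 (c * expR (- b)) 0].
  rewrite lie_algebra_lowG// => X; rewrite !inE => /orP[] /eqP ->.
    by exists a, b, 0.
  by exists 0, 0, (c * expR (- b)).
rewrite !big_cons big_nil mulr1 expmx_diag expmx_lower /expR_slope eqxx expR0.
rewrite -[RHS]/(_ *m _) mx22E; congr mx22; try ring.
by rewrite !mulr1 add0r mulrCA expR_mulN mulr1.
Qed.

Lemma lie_algebra_diagG W : linear_rel W -> lie_algebra (diagG W) = diagL W.
Proof.
move=> [_ _ WZ]; apply/seteqP; split=> X.
  move=> GX; have X01 : X 0 1 = 0.
    by apply: lie_algebra_entry0 GX => _ [a [b [_ ->]]]; rewrite mxE.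
  have X10 : X 1 0 = 0.
    by apply: lie_algebra_entry0 GX => _ [a [b [_ ->]]]; rewrite mxE.
  have [a [b [Wab]]] := lie_algebra_expmx GX.
  rewrite [X in expmx X]mx22_eta X01 X10 expmx_diag => /mx22_inj[/expR_inj Xa _ _ /expR_inj Xb].
  by exists a, b; rewrite [X in X = _]mx22_eta X01 X10 Xa Xb.
move=> [a [b [Wab ->]]] t; rewrite mx22E mulr0 expmx_diag.
by eexists _, _; split; last by []; exact: WZ.
Qed.

Lemma exp_generated_diagG W : linear_rel W -> exp_generated (diagG W).
Proof.
move=> WL; have [W0 WD WZ] := WL; split; first split.
- by move=> _ [a [b [_ ->]]]; rewrite /GL/= mx22_unit mul0r subr0 -expRD gt_eqF ?expR_gt0.
- by exists 0, 0; rewrite expR0 mx22_1.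
- move=> _ _ [a [b [Wab ->]]] [a' [b' [Wab' ->]]].
  exists (a + a'), (b + b'); split; first exact: WD.
  by rewrite mx22E !expRD; congr mx22; ring.
- move=> _ [a [b [Wab ->]]]; exists (- a), (- b).
  split; first exact: linear_relN.
  by apply: invmx_eq; rewrite mx22E mx22_1; congr mx22; rewrite ?expR_mulN; ring.
move=> _ [a [b [Wab ->]]]; exists [:: mx22 a 0 0 b].
  by rewrite lie_algebra_diagG// => X; rewrite inE => /eqP ->; exists a, b.
by rewrite big_seq1 expmx_diag.
Qed.

Lemma expmx_unip t : expmx (mx22 t 0 t t) = expR t *: mx22 1 0 t 1.
Proof.
by rewrite expmx_lower /expR_slope eqxx mx22E; congr mx22; ring.
Qed.

Lemma lie_algebra_unipG : lie_algebra unipG = unipL.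
Proof.
apply/seteqP; split=> X.
  move=> GX; have X01 : X 0 1 = 0.
    by apply: lie_algebra_entry0 GX => _ [t ->]; rewrite !mxE/= mulr0.
  have [t] := lie_algebra_expmx GX; rewrite -expmx_unip.
  rewrite [X in expmx X]mx22_eta X01 !expmx_lower.
  move=> /mx22_inj[/expR_inj Xa _ + /expR_inj Xb].
  (* Both corners carry the same non-zero slope, which cancels. *)
  rewrite Xa Xb => /(mulIf (expR_slope_neq0 _ _)) Xc.
  by exists t; rewrite [X in X = _]mx22_eta X01 Xa Xb Xc.
move=> [a ->] t; rewrite mx22E mulr0 expmx_unip.
by exists (t * a).
Qed.

Lemma exp_generated_unipG : exp_generated unipG.
Proof.
split; first split.
- move=> _ [t ->]; rewrite /GL/= mx22E mx22_unit !mulr1 mulr0 mul0r subr0.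
  by rewrite -expRD gt_eqF ?expR_gt0.
- by exists 0; rewrite expR0 scale1r mx22_1.
- move=> _ _ [t ->] [s ->]; exists (t + s).
  by rewrite !mx22E !expRD; congr mx22; ring.
- move=> _ [t ->]; exists (- t); apply: invmx_eq.
  by rewrite -scalemxAl -scalemxAr scalerA expR_mulN scale1r !mx22E mx22_1; congr mx22; ring.
move=> _ [t ->]; exists [:: mx22 t 0 t t].
  by rewrite lie_algebra_unipG// => X; rewrite inE => /eqP ->; exists t.
by rewrite big_seq1 expmx_unip.
Qed.

(** Conformality amounts to two linear equations between entries, which pass from the curve to its
    derivative. *)
Lemma lie_algebra_confG_sub W X : lie_algebra (confG W) X ->
  X = mx22 (X 0 0) (- X 1 0) (X 1 0) (X 0 0).
Proof.
move=> GX; have XD := mx_deriv_expmx0 X.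
have E01 : (fun t => expmx (t *: X) 0 1) = - (fun t => expmx (t *: X) 1 0).
  apply/funext => t; rewrite fctE; have [a [b [_ ->]]] := GX t.
  by rewrite !mxE/= mulrN.
have E11 : (fun t => expmx (t *: X) 1 1) = (fun t => expmx (t *: X) 0 0).
  by apply/funext => t; have [a [b [_ ->]]] := GX t; rewrite !mxE.
rewrite [LHS]mx22_eta; congr mx22.
  by have [_ <-] := XD 0 1; rewrite E01; have [_ <-] := is_deriveN (XD 1 0).
by have [_ <-] := XD 1 1; rewrite E11; have [_ <-] := XD 0 0.
Qed.

Lemma confL_sub_lie_algebra W : linear_rel W -> confL W `<=` lie_algebra (confG W).
Proof.
move=> [_ _ WZ] _ [a [b [Wab ->]]] t; rewrite mx22E mulrN expmx_conformal.
by exists (t * a), (t * b); split => //; exact: WZ.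
Qed.

Lemma lie_algebra_confG_plane : lie_algebra (confG plane) = confL plane.
Proof.
apply/seteqP; split; last exact/confL_sub_lie_algebra/plane_linear.
by move=> X /lie_algebra_confG_sub ->; exists (X 0 0), (X 1 0).
Qed.

(** One exponential gives the angle only modulo a full turn. So the determinant first fixes the
    modulus at every time, then the sines agree for all times, and their derivatives at 0 give b = a
    * al. *)
Lemma lie_algebra_confG_line1 al : lie_algebra (confG (line 1 al)) = confL (line 1 al).
Proof.
apply/seteqP; split; last exact/confL_sub_lie_algebra/line_linear.
move=> X GX; have XE := lie_algebra_confG_sub GX.
move: (X 0 0) (X 1 0) XE GX => a b -> GX {X}.
exists a, b; split=> //; exists a; split; first by rewrite mulr1.
have sinE t : sin (t * b) = sin (t * (a * al)).
  have [_ [_ [[s [-> ->]]]]] := GX t.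
  rewrite mx22E mulrN expmx_conformal mulr1 => E.
  have /expR_inj : expR (t * a + t * a) = expR (s + s).
    by rewrite -(det_expR_rot (t * a) (t * b)) -(det_expR_rot s (s * al)) E.
  move=> E2; have ts : t * a = s by lra.
  move: E; rewrite -ts /rot !mx22E => /mx22_inj[_ _ + _].
  by rewrite mulrA; apply: mulfI; rewrite gt_eqF ?expR_gt0.
have [_] := is_derive_sin_mul b 0; have [_] := is_derive_sin_mul (a * al) 0.
rewrite !mul0r cos0 !mulr1 => <- <-.
by under eq_fun do rewrite sinE.
Qed.

(** Only the modulus is constrained, and determinant 1 already forces it; angles need no
    comparison. *)
Lemma lie_algebra_confG_line0 : lie_algebra (confG (line 0 1)) = confL (line 0 1).
Proof.
apply/seteqP; split; last exact/confL_sub_lie_algebra/line_linear.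
move=> X GX; have XE := lie_algebra_confG_sub GX.
move: (X 0 0) (X 1 0) XE GX => a b -> GX {X}.
exists a, b; split=> //; exists b; split; last by rewrite mulr1.
have [_ [_ [[s [-> ->]]]]] := lie_algebra_expmx GX.
rewrite expmx_conformal mulr0 mulr1 => E.
have /expR_inj : expR (a + a) = expR (0 + 0).
  by rewrite -(det_expR_rot a b) -(det_expR_rot 0 s) E.
by move=> ?; lra.
Qed.

Lemma exp_generated_confG W : linear_rel W -> exp_generated (confG W).
Proof.
move=> WL; have [W0 WD WZ] := WL; split; first split.
- by move=> _ [a [b [_ ->]]]; rewrite /GL/= unitmxE det_expR_rot unitfE gt_eqF ?expR_gt0.
- by exists 0, 0; rewrite expR0 scale1r /rot cos0 sin0 oppr0 mx22_1.
- move=> _ _ [a [b [Wab ->]]] [a' [b' [Wab' ->]]].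
  exists (a + a'), (b + b'); split; first exact: WD.
  by rewrite -scalemxAl -scalemxAr scalerA rotM expRD.
- move=> _ [a [b [Wab ->]]]; exists (- a), (- b).
  split; first exact: linear_relN.
  apply: invmx_eq; rewrite -scalemxAl -scalemxAr scalerA expR_mulN rotM scale1r.
  by rewrite subrr /rot cos0 sin0 oppr0 mx22_1.
move=> _ [a [b [Wab ->]]]; exists [:: mx22 a (- b) b a].
  move=> X; rewrite inE => /eqP ->; apply: confL_sub_lie_algebra => //.
  by exists a, b.
by rewrite big_seq1 expmx_conformal.
Qed.

End Families.

(** * Lie algebras of semidirect products *)


Section BlockDerivative.
Context {R : realType} {m1 m2 n1 n2 : nat}.
Variables (F : R -> 'M[R]_(m1 + m2, n1 + n2)) (t : R) (D : 'M[R]_(m1 + m2, n1 + n2)).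
Hypothesis FD : mx_deriv F t D.

Lemma mx_deriv_ulsubmx : mx_deriv (fun x => ulsubmx (F x)) t (ulsubmx D).
Proof.
rewrite ulsubmxEsub; under eq_fun do rewrite ulsubmxEsub.
exact: mx_deriv_mxsub.
Qed.

Lemma mx_deriv_ursubmx : mx_deriv (fun x => ursubmx (F x)) t (ursubmx D).
Proof.
rewrite ursubmxEsub; under eq_fun do rewrite ursubmxEsub.
exact: mx_deriv_mxsub.
Qed.

Lemma mx_deriv_drsubmx : mx_deriv (fun x => drsubmx (F x)) t (drsubmx D).
Proof.
rewrite drsubmxEsub; under eq_fun do rewrite drsubmxEsub.
exact: mx_deriv_mxsub.
Qed.

Lemma mx_deriv_dlsubmx : mx_deriv (fun x => dlsubmx (F x)) t (dlsubmx D).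
Proof.
rewrite dlsubmxEsub; under eq_fun do rewrite dlsubmxEsub.
exact: mx_deriv_mxsub.
Qed.

End BlockDerivative.

Section BlockExponential.
Context {R : realType} {m n : nat}.
Variables (A : 'M[R]_m) (C : 'M[R]_(n, m)) (D : 'M[R]_n).
Let E t : 'M[R]_(m + n) := expmx (t *: block_mx A 0 C D).

Let DE t : mx_deriv E t (block_mx A 0 C D *m E t).
Proof. exact: mx_deriv_expmxl. Qed.

Let mulE t : block_mx A 0 C D *m E t =
  block_mx (A *m ulsubmx (E t)) (A *m ursubmx (E t))
    (C *m ulsubmx (E t) + D *m dlsubmx (E t)) (C *m ursubmx (E t) + D *m drsubmx (E t)).
Proof. by rewrite -{1}[E t]submxK mulmx_block !mul0mx !addr0. Qed.

Let E0 : E 0 = block_mx 1%:M 0 0 1%:M.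
Proof. by rewrite /E scale0r expmx0 scalar_mx_block. Qed.

Lemma ulsubmx_expmx t : ulsubmx (expmx (t *: block_mx A 0 C D)) = expmx (t *: A).
Proof.
apply: (expmx_ode (F := fun t => ulsubmx (E t))); last by rewrite E0 block_mxKul.
move=> u; have := mx_deriv_ulsubmx (DE u).
by move/mx_deriv_eq; apply => //; rewrite mulE block_mxKul.
Qed.

(** This block solves F' = A F and starts at 0. *)
Lemma ursubmx_expmx t : ursubmx (expmx (t *: block_mx A 0 C D)) = 0.
Proof.
rewrite -/(E t) (@mx_ode _ _ _ A (fun t => ursubmx (E t))).
  by rewrite E0 block_mxKur mulmx0.
move=> u; have := mx_deriv_ursubmx (DE u).
by move/mx_deriv_eq; apply => //; rewrite mulE block_mxKur.
Qed.

Lemma drsubmx_expmx t : drsubmx (expmx (t *: block_mx A 0 C D)) = expmx (t *: D).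
Proof.
apply: (expmx_ode (F := fun t => drsubmx (E t))); last by rewrite E0 block_mxKdr.
move=> u; have := mx_deriv_drsubmx (DE u).
move/mx_deriv_eq; apply => //; rewrite mulE block_mxKdr.
by rewrite ursubmx_expmx mulmx0 add0r.
Qed.

Lemma mx_deriv_dlsubmx_expmx t :
  mx_deriv (fun t => dlsubmx (expmx (t *: block_mx A 0 C D))) t
    (C *m expmx (t *: A) + D *m dlsubmx (expmx (t *: block_mx A 0 C D))).
Proof.
have := mx_deriv_dlsubmx (DE t).
by move/mx_deriv_eq; apply => //; rewrite mulE block_mxKdl ulsubmx_expmx.
Qed.

End BlockExponential.

Section SemidirectLie.
Context {R : realType}.
Implicit Types (g h s A : 'M[R]_2) (H : set 'M[R]_2).

Lemma lie_algebra_semidirect (V : {vspace 'M[R]_2}) H :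
  (forall A s, lie_algebra H A -> s \in V -> dagger (expmx A) s \in V) ->
  lie_algebra (semidirect [set` V] H) =
  [set X | exists A s, [/\ lie_algebra H A, s \in V & X = block_mx A 0 s (- A^T)]].
Proof.
move=> VH; apply/seteqP; split=> X.
  move=> GX.
  have X0 : ursubmx (X : 'M[R]_(2 + 2)) = 0.
    apply/matrixP => i j; rewrite !mxE; apply: lie_algebra_entry0 GX.
    by move=> _ [s [h [_ _ ->]]]; rewrite /Qelt (@block_mxEur _ 2 2 2 2) mxE.
  pose A := ulsubmx (X : 'M[R]_(2 + 2)); pose s := dlsubmx (X : 'M[R]_(2 + 2)).
  pose D := drsubmx (X : 'M[R]_(2 + 2)).
  have XE : X = block_mx A 0 s D by rewrite -[LHS](@submxK _ 2 2 2 2) X0.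
  (* The upper left block identifies [h]; the lower left block is then [u *m h], and the lower right
     one is the inverse transpose of [h]. *)
  have key t : exists2 u, u \in V & [/\ H (expmx (t *: A)),
     dlsubmx (expmx (t *: block_mx A 0 s D)) = u *m expmx (t *: A) &
     expmx (t *: D) = expmx (t *: - A^T)].
    have [u [h [Vu Hh tE]]] := GX t; rewrite XE in tE; exists u => //.
    have hE : h = expmx (t *: A) by rewrite -(ulsubmx_expmx A s D) tE block_mxKul.
    split; first by rewrite -hE.
      by rewrite tE block_mxKdl hE.
    rewrite -(drsubmx_expmx A s D) tE block_mxKdr hE -expmx_tr invmx_expmx.
    by rewrite linearZ/= scalerN.
  exists A, s; split.
  - by move=> t; have [u _ []] := key t.
  (* Multiplying the lower left block by the exponential of [- t *: A] recovers [u], a curve in [V]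
     whose velocity at 0 is [s]. *)
  - have DF := mx_derivM (mx_deriv_dlsubmx_expmx A s D 0) (mx_deriv_expmxl (- A) 0).
    have := mx_deriv_mem DF; rewrite !scale0r !expmx0 !mulmx1.
    rewrite (scalar_mx_block 2 2) block_mxKdl mulmx0 mul0mx !addr0; apply => t.
    have [u Vu [_ -> _]] := key t.
    by rewrite scalerN -invmx_expmx mulmxK ?expmx_unit.
  - rewrite XE; congr block_mx; apply: expmx_inj => t.
    by have [u _ []] := key t.
move=> [A [s [HA Vs ->]]] t; set E := expmx _.
(* The derivative of r is a curve in V, hence so is r. *)
pose r x := expmx (x *: A^T) *m dlsubmx (expmx (x *: block_mx A 0 s (- A^T))).
have rV x : r x \in V.
  apply: (@mem_mx_deriv _ _ _ _ r (fun x => dagger (expmx (- x *: A)) s)) => [y|y|].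
  - have := mx_derivM (mx_deriv_expmxr A^T y) (mx_deriv_dlsubmx_expmx A s (- A^T) y).
    move/mx_deriv_eq; apply => //.
    rewrite mulmxDr addrCA mulNmx mulmxN !mulmxA subrr addr0 /dagger.
    by rewrite -expmx_tr !invmx_expmx linearZ/= !scaleNr !opprK.
  - apply: VH => // z; have := HA (z * - y).
    by rewrite scalerA.
  - by rewrite /r !scale0r !expmx0 mul1mx (scalar_mx_block 2 2) block_mxKdl mem0v.
(* The lower left block equals [expmx (- t *: A^T) *m r t], which is this [dagger] term times
   [expmx (t *: A)]. *)
exists (dagger (expmx (t *: A)) (r t)), (expmx (t *: A)); split.
- apply: VH => // z; rewrite scalerA; exact: HA.
- exact: HA.
- rewrite /Qelt /dagger mulmxKV ?expmx_unit// -expmx_tr linearZ/=.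
  rewrite /r mulmxA mulVmx ?expmx_unit// mul1mx.
  rewrite -[LHS](@submxK _ 2 2 2 2) ulsubmx_expmx ursubmx_expmx drsubmx_expmx.
  by rewrite invmx_expmx scalerN.
Qed.

End SemidirectLie.

(** * The groups of the list and their Lie algebras *)


Section Members.
Context {R : realType}.
Implicit Types (m : member R).

Inductive sigma_type := TE1 | TUV | TScal | TTrace0 | TDiag | TAnti.

Definition sigma_set ty : set 'M[R]_2 :=
  match ty with
  | TE1 => Sig_e1 | TUV => Sig_uv | TScal => Sig_scal
  | TTrace0 => Sig_trace0 | TDiag => Sig_diag | TAnti => Sig_anti
  end.

(** These are associative algebras, so they play two roles: they contain the infinitesimal
    stabilizer of Sigma, and their elements also preserve Sigma under congruence. *)
Definition stab_alg ty : set 'M[R]_2 :=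
  match ty with
  | TE1 => lowL plane
  | TUV => trset (lowL plane)
  | TScal | TTrace0 => confL plane
  | TDiag | TAnti => diagL plane
  end.

Definition member_type m :=
  match m with
  | b1 | c2 _ | c3 => TTrace0
  | a1 | b3 _ | b4 | b5 | c7 _ | c8 | c9 | c10 => TUV
  | b6 | c12 _ => TDiag
  | b2 | c4 _ | c5 | c6 | d3 _ | d4 | d5 | d6 => TE1
  | c1 | d1 _ | d2 => TScal
  | c11 | d7 _ => TAnti
  end.

Lemma member_SigmaE m : member_Sigma m = sigma_set (member_type m).
Proof. by case: m. Qed.

(** The list rewritten through four families and transposition, so that Lie algebras and dimensions
    are computed per family and not per member. *)
Definition member_G m : set 'M[R]_2 :=
  match m with
  | a1 => trset (lowG plane)
  | b1 | c1 => confG plane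
  | b2 => lowG plane
  | b3 la => trset (lowG (line la (la + 1)))
  | b4 | b6 | c5 | c11 => diagG plane
  | b5 => trset (lowG (line 1 1))
  | c2 al | d1 al => confG (line 1 al)
  | c3 | d2 => confG (line 0 1)
  | c4 la => lowG (line la (la + 1))
  | c6 => lowG (line 1 1)
  | c7 la | d3 la => diagG (line la (la + 1))
  | c8 => trset (lowG (line 0 0))
  | c9 => trset unipG
  | c10 | d6 => diagG (line 1 1)
  | c12 be | d7 be => diagG (line 1 be)
  | d4 => lowG (line 0 0)
  | d5 => unipG
  end.

Definition member_L m : set 'M[R]_2 :=
  match m with
  | a1 => trset (lowL plane)
  | b1 | c1 => confL plane
  | b2 => lowL plane
  | b3 la => trset (lowL (line la (la + 1)))
  | b4 | b6 | c5 | c11 => diagL plane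
  | b5 => trset (lowL (line 1 1))
  | c2 al | d1 al => confL (line 1 al)
  | c3 | d2 => confL (line 0 1)
  | c4 la => lowL (line la (la + 1))
  | c6 => lowL (line 1 1)
  | c7 la | d3 la => diagL (line la (la + 1))
  | c8 => trset (lowL (line 0 0))
  | c9 => trset unipL
  | c10 | d6 => diagL (line 1 1)
  | c12 be | d7 be => diagL (line 1 be)
  | d4 => lowL (line 0 0)
  | d5 => unipL
  end.

Lemma trset_exists T (f : T -> 'M[R]_2) :
  trset [set h | exists t, h = f t] = [set h | exists t, h = (f t)^T].
Proof.
by apply/seteqP; split=> h [t ht]; exists t; rewrite /= ?ht ?trmxK// -[LHS]trmxK ht.
Qed.

Lemma member_HE m : member_H m = member_G m.
Proof.
have conf u v : confG (line u v) =
    [set h | exists t, h = expR (t * u) *: rot (t * v)] :> set 'M[R]_2.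
  apply/seteqP; split=> [_ [_ [_ [[t [-> ->]] ->]]]|_ [t ->]]; first by exists t.
  by exists (t * u), (t * v); split => //; exists t.
have diag u v : diagG (line u v) =
    [set h | exists t, h = mx22 (expR (t * u)) 0 0 (expR (t * v))] :> set 'M[R]_2.
  apply/seteqP; split=> [_ [_ [_ [[t [-> ->]] ->]]]|_ [t ->]]; first by exists t.
  by exists (t * u), (t * v); split => //; exists t.
have low u v : lowG (line u v) =
    [set h | exists t s, h = mx22 (expR (t * u)) 0 s (expR (t * v))] :> set 'M[R]_2.
  apply/seteqP; split=> [_ [_ [_ [s [[t [-> ->]] ->]]]]|_ [t [s ->]]]; first by exists t, s.
  by exists (t * u), (t * v), s; split => //; exists t.
have up u v : trset (lowG (line u v)) =
    [set h | exists t s, h = mx22 (expR (t * u)) s 0 (expR (t * v))] :> set 'M[R]_2.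
  rewrite low; apply/seteqP; split=> h [t [s hE]]; exists t, s.
    by rewrite -[LHS]trmxK hE mx22T.
  by rewrite hE mx22T.
have confP : confG plane = [set h | exists t x, h = expR t *: rot x] :> set 'M[R]_2.
  by apply/seteqP; split=> [_ [t [x [_ ->]]]|_ [t [x ->]]]; exists t, x.
have diagP : diagG plane =
    [set h | exists t s, h = mx22 (expR t) 0 0 (expR s)] :> set 'M[R]_2.
  by apply/seteqP; split=> [_ [t [x [_ ->]]]|_ [t [x ->]]]; exists t, x.
have lowP : lowG plane =
    [set h | exists t s r, h = mx22 (expR t) 0 r (expR s)] :> set 'M[R]_2.
  by apply/seteqP; split=> [_ [t [x [s [_ ->]]]]|_ [t [x [s ->]]]]; exists t, x, s.
have e0 t : expR (t * 0) = 1 :> R by rewrite mulr0 expR0.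
case: m => [|||la||||| al||la|||la|||||be|al||la||||be];
  rewrite /= ?conf ?up ?low ?diag ?confP ?diagP ?lowP //.
- apply/seteqP; split=> h [t [s [r hE]]]; exists t, s, r.
    by rewrite hE mx22T.
  by rewrite -[LHS]trmxK hE mx22T.
- by under [RHS]eq_set do under eq_exists do under eq_exists do rewrite !mulr1.
- by under [RHS]eq_set do under eq_exists do rewrite mulr1.
- by under [RHS]eq_set do under eq_exists do rewrite e0 scale1r mulr1.
- by under [RHS]eq_set do under eq_exists do under eq_exists do rewrite !mulr1.
- under [LHS]eq_set do under eq_exists do rewrite mx22E mulr1 !mulr0 -expRD.
  by under [RHS]eq_set do under eq_exists do rewrite mulrDr mulr1.
- under [RHS]eq_set do under eq_exists do under eq_exists do rewrite !e0.
  by apply/seteqP; split=> h [t]; [move=> hE; exists 0, t | move=> [s hE]; exists s].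
- rewrite trset_exists.
  by under [RHS]eq_set do under eq_exists do rewrite linearZ/= mx22T.
- by under [RHS]eq_set do under eq_exists do rewrite mulr1.
- by under [RHS]eq_set do under eq_exists do rewrite mulr1.
- by under [RHS]eq_set do under eq_exists do rewrite mulr1.
- by under [RHS]eq_set do under eq_exists do rewrite e0 scale1r mulr1.
- under [LHS]eq_set do under eq_exists do rewrite mx22E mulr1 !mulr0 -expRD.
  by under [RHS]eq_set do under eq_exists do rewrite mulrDr mulr1.
- under [RHS]eq_set do under eq_exists do under eq_exists do rewrite !e0.
  by apply/seteqP; split=> h [t]; [move=> hE; exists 0, t | move=> [s hE]; exists s].
- by under [RHS]eq_set do under eq_exists do rewrite mulr1.
- by under [RHS]eq_set do under eq_exists do rewrite mulr1.
Qed.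

End Members.


Section MemberLie.
Context {R : realType}.
Implicit Types (m : member R).
Local Hint Resolve plane_linear line_linear : core.

Lemma exp_generated_member m : exp_generated (member_H m).
Proof.
rewrite member_HE; case: m => * /=; try apply: exp_generated_trset;
by [exact: exp_generated_lowG|exact: exp_generated_diagG|exact: exp_generated_confG
   |exact: exp_generated_unipG].
Qed.

Lemma lie_algebra_member m : lie_algebra (member_H m) = member_L m.
Proof.
rewrite member_HE; case: m => * /=; rewrite ?lie_algebra_trset;
by rewrite ?lie_algebra_lowG// ?lie_algebra_diagG// ?lie_algebra_unipG//
  ?lie_algebra_confG_plane ?lie_algebra_confG_line0 ?lie_algebra_confG_line1.
Qed.

Lemma member_H_stab m : member_H m `<=` stab_alg (member_type m).
Proof.
have lG W : lowG W `<=` lowL (@plane R).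
  by move=> _ [a [b [c [_ ->]]]]; exists (expR a), (expR b), c.
have uG : @unipG R `<=` lowL plane.
  by move=> _ [t ->]; rewrite mx22E mulr0; eexists _, _, _.
have dG W : diagG W `<=` diagL (@plane R).
  by move=> _ [a [b [_ ->]]]; exists (expR a), (expR b).
have dlG W : diagG W `<=` lowL (@plane R).
  by move=> _ [a [b [_ ->]]]; exists (expR a), (expR b), 0.
have dtG W : diagG W `<=` trset (lowL (@plane R)).
  by move=> _ [a [b [_ ->]]]; rewrite /trset/= mx22T; exists (expR a), (expR b), 0.
have cG W : confG W `<=` confL (@plane R).
  by move=> _ [a [b [_ ->]]]; rewrite /rot mx22E mulrN; eexists _, _.
rewrite member_HE; case: m => *;
by move=> h; first [exact: lG|exact: uG|exact: dG|exact: dlG|exact: dtG|exact: cG].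
Qed.

Lemma sigma_stab ty k s : stab_alg ty k -> sigma_set ty s ->
  sigma_set ty (k^T *m s *m k : 'M[R]_2).
Proof.
case: ty => /=.
- move=> [a [b [c [_ ->]]]] [u ->]; exists (a * u * a).
  by rewrite !mx22E; congr mx22; ring.
- move=> [a [b [c [_ kE]]]] [u [v ->]]; rewrite kE -[k]trmxK kE.
  by rewrite !mx22E; eexists (a * u * b), _; congr mx22; ring.
- move=> [a [b [_ ->]]] [u ->]; exists ((a * a + b * b) * u).
  by rewrite !mx22E; congr mx22; ring.
- move=> [a [b [_ ->]]] [u [v ->]].
  (* The real and imaginary parts of (a - ib)^2 (u + iv). *)
  exists (a * a * u + 2 * a * b * v - b * b * u), (a * a * v - 2 * a * b * u - b * b * v).
  by rewrite !mx22E; congr mx22; ring.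
- move=> [a [b [_ ->]]] [u [v ->]]; exists (a * u * a), (b * v * b).
  by rewrite !mx22E; congr mx22; ring.
- move=> [a [b [_ ->]]] [u ->]; exists (a * u * b).
  by rewrite !mx22E; congr mx22; ring.
Qed.

Lemma member_dagger m (h s : 'M[R]_2) : member_H m h -> member_Sigma m s ->
  member_Sigma m (dagger h s).
Proof.
move=> Hh; rewrite !member_SigmaE /dagger -trmx_inv; apply: sigma_stab.
by apply: member_H_stab; have [[_ _ _ +] _] := exp_generated_member m; exact.
Qed.

End MemberLie.

Section Dimension.
Context {R : realType}.

(** [has_dimension G d] is this property of [lie_algebra G]. *)
Definition has_dim n (S : set 'M[R]_n) (d : nat) :=
  exists2 V : {vspace 'M[R]_n}, S = [set` V] & \dim V = d.

Lemma has_dim_span n d (B : d.-tuple 'M[R]_n) S :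
  (forall c : 'I_d -> R, \sum_i c i *: B`_i = 0 -> forall i, c i = 0) ->
  (forall X, S X <-> exists c : 'I_d -> R, X = \sum_i c i *: B`_i) ->
  has_dim S d.
Proof.
move=> /freeP/eqP freeB SE; exists <<B>>%VS; last by rewrite freeB size_tuple.
apply/seteqP; split=> X /=.
  move=> /SE[c ->]; apply: memv_suml => i _; apply/memvZ/memv_span/mem_nth.
  by rewrite size_tuple.
by move/coord_span => XE; apply/SE; exists (fun i => coord B i X).
Qed.

Lemma has_dim_trset n (S : set 'M[R]_n) d : has_dim S d -> has_dim (trset S) d.
Proof.
move=> [V -> Vd]; exists (linfun (@trmx R n n) @: V)%VS.
  apply/seteqP; split=> X; rewrite /trset/=.
    by move=> XV; apply/memv_imgP; exists X^T => //; rewrite lfunE/= trmxK.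
  by move=> /memv_imgP[Y YV ->]; rewrite lfunE/= trmxK.
rewrite limg_dim_eq//; apply/eqP; rewrite -subv0; apply/subvP => X.
by rewrite memv_cap memv_ker lfunE/= trmx_eq0 memv0 => /andP[].
Qed.

End Dimension.


Section BlockEmbeddings.
Context {R : realType}.

(** The translation part and the differential of [embGL]; their images will span the Lie algebra of
    a semidirect product. *)
Definition lower_block (s : 'M[R]_2) : 'M[R]_4 := @block_mx R 2 2 2 2 0 0 s 0.
Definition diag_block (A : 'M[R]_2) : 'M[R]_4 := @block_mx R 2 2 2 2 A 0 0 (- A^T).

Fact lower_block_is_linear : linear lower_block.
Proof.
move=> k x y; rewrite /lower_block (@scale_block_mx _ 2 2 2 2) (@add_block_mx _ 2 2 2 2).
by rewrite !scaler0 !addr0.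
Qed.

Fact diag_block_is_linear : linear diag_block.
Proof.
move=> k x y; rewrite /diag_block (@scale_block_mx _ 2 2 2 2) (@add_block_mx _ 2 2 2 2).
by rewrite !scaler0 !addr0 linearP/= scalerN opprD.
Qed.

HB.instance Definition _ :=
  GRing.isLinear.Build R 'M[R]_2 'M[R]_4 _ lower_block lower_block_is_linear.
HB.instance Definition _ :=
  GRing.isLinear.Build R 'M[R]_2 'M[R]_4 _ diag_block diag_block_is_linear.

End BlockEmbeddings.

Section MemberDimension.
Context {R : realType}.
Implicit Types (m : member R) (S : set 'M[R]_2).

Lemma has_dim1 (B : 'M[R]_2) S :
  (forall u, u *: B = 0 -> u = 0) ->
  (forall X, S X <-> exists u, X = u *: B) -> has_dim S 1.
Proof.
move=> freeB SE; apply: (@has_dim_span _ _ _ [tuple B]) => [c|X].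
  by rewrite big_ord1/= => /freeB c0 i; rewrite ord1.
split=> [/SE[u ->]|[c ->]]; first by exists (fun=> u); rewrite big_ord1.
by rewrite big_ord1; apply/SE; exists (c 0).
Qed.

Lemma has_dim2 (B C : 'M[R]_2) S :
  (forall u v, u *: B + v *: C = 0 -> u = 0 /\ v = 0) ->
  (forall X, S X <-> exists u v, X = u *: B + v *: C) -> has_dim S 2.
Proof.
move=> freeB SE; apply: (@has_dim_span _ _ _ [tuple B; C]) => [c|X].
  rewrite !big_ord_recl big_ord0/= addr0 => /freeB[c0 c1] i.
  by case: (unliftP ord0 i) => [j|] ->; rewrite ?ord1.
split=> [/SE[u [v ->]]|[c ->]].
  exists (fun i => if i == 0 then u else v).
  by rewrite !big_ord_recl big_ord0/= addr0.
rewrite !big_ord_recl big_ord0/= addr0; apply/SE.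
by exists (c 0), (c (lift ord0 ord0)).
Qed.

Lemma has_dim3 (B C D : 'M[R]_2) S :
  (forall u v w, u *: B + v *: C + w *: D = 0 -> [/\ u = 0, v = 0 & w = 0]) ->
  (forall X, S X <-> exists u v w, X = u *: B + v *: C + w *: D) -> has_dim S 3.
Proof.
move=> freeB SE; apply: (@has_dim_span _ _ _ [tuple B; C; D]) => [c|X].
  rewrite !big_ord_recl big_ord0/= addr0 addrA => /freeB[c0 c1 c2] i.
  case: (unliftP ord0 i) => [j|] -> //.
  by case: (unliftP ord0 j) => [l|] ->; rewrite ?ord1.
split=> [/SE[u [v [w ->]]]|[c ->]].
  exists (fun i : 'I_3 => if i == 0 then u else if i == 1 then v else w).
  by rewrite !big_ord_recl big_ord0/= addr0 addrA.
rewrite !big_ord_recl big_ord0/= addr0 addrA; apply/SE.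
by exists (c 0), (c (lift ord0 ord0)), (c (lift ord0 (lift ord0 ord0))).
Qed.

Definition sigma_dim ty : nat :=
  match ty with TE1 | TScal | TAnti => 1 | TUV | TTrace0 | TDiag => 2 end.

Lemma has_dim_sigma ty : has_dim (@sigma_set R ty) (sigma_dim ty).
Proof.
case: ty => /=.
- apply: (@has_dim1 (mx22 1 0 0 0)) => [u|X].
    by rewrite mx22E mx22_0 => /mx22_inj[+ _ _ _]; rewrite mulr1.
  by split=> [[u ->]|[u ->]]; exists u; rewrite mx22E; congr mx22; ring.
- apply: (@has_dim2 (mx22 0 1 1 0) (mx22 0 0 0 1)) => [u v|X].
    by rewrite !mx22E mx22_0 => /mx22_inj[_ + _ +]; rewrite !mulr1 !mulr0 addr0 add0r.
  by split=> [[u [v ->]]|[u [v ->]]]; exists u, v; rewrite !mx22E; congr mx22; ring.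
- apply: (@has_dim1 (mx22 1 0 0 1)) => [u|X].
    by rewrite mx22E mx22_0 => /mx22_inj[+ _ _ _]; rewrite mulr1.
  by split=> [[u ->]|[u ->]]; exists u; rewrite mx22E; congr mx22; ring.
- apply: (@has_dim2 (mx22 1 0 0 (- 1)) (mx22 0 1 1 0)) => [u v|X].
    by rewrite !mx22E mx22_0 => /mx22_inj[+ + _ _]; rewrite !mulr1 !mulr0 addr0 add0r.
  by split=> [[u [v ->]]|[u [v ->]]]; exists u, v; rewrite !mx22E; congr mx22; ring.
- apply: (@has_dim2 (mx22 1 0 0 0) (mx22 0 0 0 1)) => [u v|X].
    by rewrite !mx22E mx22_0 => /mx22_inj[+ _ _ +]; rewrite !mulr1 !mulr0 addr0 add0r.
  by split=> [[u [v ->]]|[u [v ->]]]; exists u, v; rewrite !mx22E; congr mx22; ring.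
- apply: (@has_dim1 (mx22 0 1 1 0)) => [u|X].
    by rewrite mx22E mx22_0 => /mx22_inj[_ + _ _]; rewrite mulr1.
  by split=> [[u ->]|[u ->]]; exists u; rewrite mx22E; congr mx22; ring.
Qed.

Lemma has_dim_lowL_plane : has_dim (@lowL R plane) 3.
Proof.
apply: (@has_dim3 (mx22 1 0 0 0) (mx22 0 0 0 1) (mx22 0 0 1 0)) => [u v w|X].
  rewrite !mx22E mx22_0 => /mx22_inj[]; rewrite !mulr1 !mulr0 !addr0 !add0r.
  by move=> -> _ -> ->.
split=> [[u [v [w [_ ->]]]]|[u [v [w ->]]]]; exists u, v, w.
  by rewrite !mx22E; congr mx22; ring.
by split=> //; rewrite !mx22E; congr mx22; ring.
Qed.

Lemma has_dim_lowL_line (u v : R) : ~ (u = 0 /\ v = 0) -> has_dim (lowL (line u v)) 2.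
Proof.
move=> uv0; apply: (@has_dim2 (mx22 u 0 0 v) (mx22 0 0 1 0)) => [s w|X].
  rewrite !mx22E mx22_0 => /mx22_inj[]; rewrite !mulr1 !mulr0 !addr0 !add0r.
  move=> /eqP + _ -> /eqP; rewrite !mulf_eq0; have [//|_/= /eqP u0 /eqP v0] := eqVneq s 0.
  by have [] := uv0.
split=> [[_ [_ [w [[s [-> ->]] ->]]]]|[s [w ->]]].
  by exists s, w; rewrite !mx22E; congr mx22; ring.
exists (s * u), (s * v), w; split; first by exists s.
by rewrite !mx22E; congr mx22; ring.
Qed.

Lemma has_dim_lowL_line0 : has_dim (@lowL R (line 0 0)) 1.
Proof.
apply: (@has_dim1 (mx22 0 0 1 0)) => [u|X].
  by rewrite mx22E mx22_0 => /mx22_inj[_ _ + _]; rewrite mulr1.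
split=> [[_ [_ [w [[s [-> ->]] ->]]]]|[w ->]].
  by exists w; rewrite !mx22E; congr mx22; ring.
exists 0, 0, w; split; first by exists 0; rewrite mulr0.
by rewrite !mx22E; congr mx22; ring.
Qed.

Lemma has_dim_diagL_plane : has_dim (@diagL R plane) 2.
Proof.
apply: (@has_dim2 (mx22 1 0 0 0) (mx22 0 0 0 1)) => [u v|X].
  by rewrite !mx22E mx22_0 => /mx22_inj[+ _ _ +]; rewrite !mulr1 !mulr0 addr0 add0r.
split=> [[u [v [_ ->]]]|[u [v ->]]]; exists u, v; rewrite ?mx22E.
  by congr mx22; ring.
by split=> //; congr mx22; ring.
Qed.

Lemma has_dim_diagL_line (u v : R) : ~ (u = 0 /\ v = 0) -> has_dim (diagL (line u v)) 1.
Proof.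
move=> uv0; apply: (@has_dim1 (mx22 u 0 0 v)) => [s|X].
  rewrite !mx22E mx22_0 => /mx22_inj[/eqP + _ _ /eqP]; rewrite !mulf_eq0.
  have [//|_/= /eqP u0 /eqP v0] := eqVneq s 0.
  by have [] := uv0.
split=> [[_ [_ [[s [-> ->]] ->]]]|[s ->]].
  by exists s; rewrite !mx22E; congr mx22; ring.
exists (s * u), (s * v); split; first by exists s.
by rewrite !mx22E; congr mx22; ring.
Qed.

Lemma has_dim_confL_plane : has_dim (@confL R plane) 2.
Proof.
apply: (@has_dim2 (mx22 1 0 0 1) (mx22 0 (- 1) 1 0)) => [u v|X].
  by rewrite !mx22E mx22_0 => /mx22_inj[+ _ + _]; rewrite !mulr1 !mulr0 addr0 add0r.
split=> [[u [v [_ ->]]]|[u [v ->]]]; exists u, v; rewrite ?mx22E.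
  by congr mx22; ring.
by split=> //; congr mx22; ring.
Qed.

Lemma has_dim_confL_line (u v : R) : ~ (u = 0 /\ v = 0) -> has_dim (confL (line u v)) 1.
Proof.
move=> uv0; apply: (@has_dim1 (mx22 u (- v) v u)) => [s|X].
  rewrite !mx22E mx22_0 => /mx22_inj[/eqP + _ /eqP + _]; rewrite !mulf_eq0.
  have [//|_/= /eqP u0 /eqP v0] := eqVneq s 0.
  by have [] := uv0.
split=> [[_ [_ [[s [-> ->]] ->]]]|[s ->]].
  by exists s; rewrite !mx22E; congr mx22; ring.
exists (s * u), (s * v); split; first by exists s.
by rewrite !mx22E; congr mx22; ring.
Qed.

Lemma has_dim_unipL : has_dim (@unipL R) 1.
Proof.
apply: (@has_dim1 (mx22 1 0 1 1)) => [u|X].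
  by rewrite mx22E mx22_0 => /mx22_inj[+ _ _ _]; rewrite mulr1.
by split=> [[u ->]|[u ->]]; exists u; rewrite mx22E; congr mx22; ring.
Qed.

(** The subtraction is never truncated: every [member_dim] exceeds the dimension of its Sigma. *)
Lemma has_dim_member_L m :
  has_dim (member_L m) (member_dim m - sigma_dim (member_type m)).
Proof.
have n10 : ~ ((1 : R) = 0 /\ (1 : R) = 0) by move=> [/eqP]; rewrite oner_eq0.
have n1 (x : R) : ~ ((1 : R) = 0 /\ x = 0) by move=> [/eqP]; rewrite oner_eq0.
have n01 : ~ ((0 : R) = 0 /\ (1 : R) = 0) by move=> [_ /eqP]; rewrite oner_eq0.
(* The generator (la, la + 1) is non-zero for every la, so no parameter value is degenerate. *)
have nl (x : R) : ~ (x = 0 /\ x + 1 = 0).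
  by move=> [-> /eqP]; rewrite add0r oner_eq0.
case: m => *; rewrite [(_ - _)%N]/=; try apply: has_dim_trset;
by first [exact: has_dim_lowL_plane | exact: has_dim_lowL_line0 | exact: has_dim_lowL_line
  | exact: has_dim_diagL_plane | exact: has_dim_diagL_line
  | exact: has_dim_confL_plane | exact: has_dim_confL_line | exact: has_dim_unipL].
Qed.

(** Both embeddings are injective, and their images meet in 0 because they occupy different
    blocks. *)
Lemma has_dimension_semidirect (V : {vspace 'M[R]_2}) (H : set 'M[R]_2) d :
  (forall A s, lie_algebra H A -> s \in V -> dagger (expmx A) s \in V) ->
  has_dim (lie_algebra H) d ->
  has_dimension (semidirect [set` V] H) (\dim V + d).
Proof.
move=> VH [U HU Ud].
have fE s : linfun (@lower_block R) s = @block_mx R 2 2 2 2 0 0 s 0 by rewrite lfunE.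
have gE A : linfun (@diag_block R) A = @block_mx R 2 2 2 2 A 0 0 (- A^T) by rewrite lfunE.
exists (linfun (@lower_block R) @: V + linfun (@diag_block R) @: U)%VS.
  rewrite lie_algebra_semidirect//; apply/seteqP; split=> X /=.
    move=> [A [s [HA Vs ->]]]; rewrite HU /= in HA.
    apply/memv_addP; exists (linfun (@lower_block R) s); first exact: memv_img.
    exists (linfun (@diag_block R) A); first exact: memv_img.
    by rewrite fE gE (@add_block_mx _ 2 2 2 2) !add0r addr0.
  move=> /memv_addP[_ /memv_imgP[s Vs ->] [_ /memv_imgP[A UA ->] ->]].
  exists A, s; split=> //; first by rewrite HU.
  by rewrite fE gE (@add_block_mx _ 2 2 2 2) !add0r addr0.
rewrite dimv_disjoint_sum.
  congr (_ + _)%N; rewrite limg_dim_eq//; apply/eqP; rewrite -subv0; apply/subvP => X;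
    rewrite memv_cap memv_ker memv0 => /andP[_ /eqP]; rewrite ?fE ?gE.
    by rewrite -(@block_mx0 _ 2 2 2 2) => /(@eq_block_mx _ 2 2 2 2)[_ _ -> _].
  by rewrite -(@block_mx0 _ 2 2 2 2) => /(@eq_block_mx _ 2 2 2 2)[-> _ _ _].
apply/eqP; rewrite -subv0; apply/subvP => X.
rewrite memv_cap => /andP[/memv_imgP[s _ ->] /memv_imgP[A _]].
rewrite fE gE => /(@eq_block_mx _ 2 2 2 2)[_ _ -> _].
by rewrite (@block_mx0 _ 2 2 2 2) mem0v.
Qed.

Lemma has_dimension_member m : has_dimension (member_group m) (member_dim m).
Proof.
have [V VE Vd] := has_dim_sigma (member_type m).
have -> : member_dim m = (\dim V + (member_dim m - sigma_dim (member_type m)))%N.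
  by rewrite Vd; case: (m).
rewrite /member_group member_SigmaE VE; apply: has_dimension_semidirect.
  move=> A s HA sV.
  have : (sigma_set (member_type m)) s by rewrite VE.
  rewrite -member_SigmaE => /(member_dagger (lie_algebra_expmx HA)).
  by rewrite member_SigmaE VE.
rewrite lie_algebra_member; exact: has_dim_member_L.
Qed.

End MemberDimension.

(** * Lie subalgebras of the stabilizers *)


Section LieSets.
Context {R : realType} {n : nat}.
Implicit Types (L : set 'M[R]_n).

Definition lie_set L := [/\ L 0, forall X Y, L X -> L Y -> L (X + Y),
  forall k X, L X -> L (k *: X) & forall X Y, L X -> L Y -> L (X *m Y - Y *m X)].

Lemma lie_set_conj g L : g \in unitmx -> lie_set L -> lie_set (conj_set g L).
Proof.
move=> gu [L0 LD LZ LB]; split.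
- by exists 0 => //; rewrite mulmx0 mul0mx.
- move=> _ _ [X LX <-] [Y LY <-]; exists (X + Y); first exact: LD.
  by rewrite mulmxDr mulmxDl.
- move=> k _ [X LX <-]; exists (k *: X); first exact: LZ.
  by rewrite -scalemxAr -scalemxAl.
- move=> _ _ [X LX <-] [Y LY <-]; exists (X *m Y - Y *m X); first exact: LB.
  by rewrite mulmxBr mulmxBl !mulmxA !(mulmxKV gu).
Qed.

Lemma lie_set_trset L : lie_set L -> lie_set (trset L).
Proof.
rewrite /trset/=; move=> [L0 LD LZ LB]; split=> /=.
- by rewrite trmx0.
- by move=> X Y; rewrite linearD; exact: LD.
- by move=> k X; rewrite linearZ; exact: LZ.
- by move=> X Y LX LY; rewrite linearB/= !trmx_mul; exact: LB.
Qed.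

Lemma conj_set1 L : conj_set 1%:M L = L.
Proof.
apply/seteqP; split=> [_ [X LX <-]|X LX]; first by rewrite invmx1 mul1mx mulmx1.
by exists X => //; rewrite invmx1 mul1mx mulmx1.
Qed.

Lemma conj_setM g h L : g \in unitmx -> h \in unitmx ->
  conj_set g (conj_set h L) = conj_set (g *m h) L.
Proof.
move=> gu hu; have ghV : invmx (g *m h) = invmx h *m invmx g.
  by apply: invmx_eq; rewrite mulmxA mulmxK// mulmxV.
apply/seteqP; split=> [_ [_ [X LX <-] <-]|_ [X LX <-]].
  by exists X => //; rewrite ghV !mulmxA.
exists (h *m X *m invmx h); first by exists X.
by rewrite ghV !mulmxA.
Qed.

Lemma conj_set_trset g L : g \in unitmx ->
  conj_set g (trset L) = trset (conj_set (invmx g^T) L).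
Proof.
move=> gu; apply/seteqP; split=> [_ [X LX <-]|X [Y LY YX]].
  exists X^T; first by [].
  by rewrite invmxK !trmx_mul trmx_inv mulmxA.
exists Y^T; first by rewrite /trset/= trmxK.
by rewrite -[RHS]trmxK -YX !trmx_mul invmxK trmx_inv trmxK mulmxA.
Qed.

End LieSets.

(** * Lower triangular subalgebras *)

Section TriangularKinds.
Context {R : realType}.
Implicit Types (L : set 'M[R]_2) (a b c d p q r u v la al be : R).

(** The first four kinds contain the nilpotent E21, the last four do not. *)
Inductive low_kind :=
| LowPlane | LowLine of R | LowScal | LowNil | LowDiag | LowDiagLine of R | LowUnip | LowHom.

Definition low_kind_L k : set 'M[R]_2 :=
  match k with
  | LowPlane => lowL plane
  | LowLine la => lowL (line la (la + 1))
  | LowScal => lowL (line 1 1)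
  | LowNil => lowL (line 0 0)
  | LowDiag => diagL plane
  | LowDiagLine la => diagL (line la (la + 1))
  | LowUnip => unipL
  | LowHom => diagL (line 1 1)
  end.

(** Exactly the matrices that preserve the line of E11, hence the conjugations that are available
    once Sigma is fixed. *)
Definition lower_unit : set 'M[R]_2 :=
  [set g | exists p q r, [/\ p != 0, r != 0 & g = mx22 p 0 q r]].

Lemma lower_unit_unitmx g : lower_unit g -> g \in unitmx.
Proof. by move=> [p [q [r [p0 r0 ->]]]]; rewrite mx22_unit mul0r subr0 mulf_neq0. Qed.

Lemma lower_unit1 : lower_unit 1%:M.
Proof. by exists 1, 0, 1; rewrite mx22_1 oner_neq0. Qed.

Lemma invmx_lower p q r : p != 0 -> r != 0 ->
  invmx (mx22 p 0 q r) = mx22 p^-1 0 (- q / (p * r)) r^-1.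
Proof.
move=> p0 r0; apply: invmx_eq; rewrite mx22E mx22_1; congr mx22.
- by rewrite mulfV// mul0r addr0.
- by ring.
- by field; apply/andP.
- by rewrite mulfV// mulr0 add0r.
Qed.

Lemma conj_lower p q r a c b : p != 0 -> r != 0 ->
  mx22 p 0 q r *m mx22 a 0 c b *m invmx (mx22 p 0 q r) =
  mx22 a 0 ((q * a + r * c - b * q) / p) b.
Proof.
move=> p0 r0; rewrite invmx_lower// !mx22E; congr mx22; field; rewrite ?p0 ?r0//.
Qed.

Lemma plane_or_line (W : R -> R -> Prop) : linear_rel W ->
  [\/ (forall a b, W a b),
    exists u v, ~ (u = 0 /\ v = 0) /\ forall a b, W a b <-> line u v a b |
    forall a b, W a b <-> a = 0 /\ b = 0].
Proof.
move=> [W0 WD WZ].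
have [[u [v [Wuv uv0]]]|noW] :=
    pselect (exists u v, W u v /\ ~ (u = 0 /\ v = 0)); last first.
  apply: Or33 => a b; split=> [Wab|[-> ->]//].
  by apply: contrapT => ab0; apply: noW; exists a, b.
have [[u' [v' [Wuv' D0]]]|prop] :=
    pselect (exists u' v', W u' v' /\ u * v' - v * u' != 0).
  apply: Or31 => a b; set D := u * v' - v * u' in D0.
  (* Cramer's rule for (a, b) in the basis (u, v), (u', v'). *)
  have := WD _ _ _ _ (WZ ((a * v' - b * u') / D) _ _ Wuv) (WZ ((b * u - a * v) / D) _ _ Wuv').
  by congr W; rewrite /D; field; rewrite -/D.
apply: Or32; exists u, v; split=> // a b; split=> [Wab|[t [-> ->]]]; last exact: WZ.
have E : u * b = v * a.
  by apply/eqP; rewrite -subr_eq0; apply: contraT => D; case: prop; exists a, b.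
have [u0|u0] := eqVneq u 0; last first.
  by exists (a / u); split; [field|rewrite mulrAC [a * v]mulrC -E mulrAC mulfV// mul1r].
have v0 : v != 0 by apply/eqP => v0; exact: uv0.
exists (b / v); split; last by field.
by rewrite u0 mulr0; move: E => /esym/eqP; rewrite u0 mul0r mulf_eq0 (negPf v0) => /eqP.
Qed.

(** Off the diagonal line the generator can be scaled to have coordinate difference 1, which gives
    la = u / (v - u). *)
Lemma line_normalize u v : ~ (u = 0 /\ v = 0) ->
  (forall a b, line u v a b <-> line 1 1 a b) \/
  exists la, forall a b, line u v a b <-> line la (la + 1) a b.
Proof.
move=> uv0; have [uv|uv] := eqVneq u v.
  left=> a b; have u0 : u != 0 by apply/eqP => u0; apply: uv0; rewrite -uv.
  split=> [[t [-> ->]]|[t [-> ->]]]; first by exists (t * u); rewrite -uv !mulr1.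
  by exists (t / u); rewrite -uv mulr1 divfK.
right; have D : v - u != 0 by rewrite subr_eq0 eq_sym.
exists (u / (v - u)) => a b; split=> [[t [-> ->]]|[t [-> ->]]].
  by exists (t * (v - u)); split; field.
by exists (t / (v - u)); split; field.
Qed.

Lemma lowL_ext (W W' : R -> R -> Prop) : (forall a b, W a b <-> W' a b) -> lowL W = lowL W'.
Proof.
by move=> E; apply/seteqP; split=> X [a [b [c [Wab ->]]]]; exists a, b, c; split => //; apply/E.
Qed.

Lemma diagL_ext (W W' : R -> R -> Prop) : (forall a b, W a b <-> W' a b) -> diagL W = diagL W'.
Proof.
by move=> E; apply/seteqP; split=> X [a [b [Wab ->]]]; exists a, b; split => //; apply/E.
Qed.

Lemma confL_ext (W W' : R -> R -> Prop) : (forall a b, W a b <-> W' a b) -> confL W = confL W'.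
Proof.
by move=> E; apply/seteqP; split=> X [a [b [Wab ->]]]; exists a, b; split => //; apply/E.
Qed.

Lemma lie_set_diag_rel L : lie_set L -> linear_rel (fun a b => L (mx22 a 0 0 b)).
Proof.
move=> [L0 LD LZ _]; split=> [|a b c d La Lc|t a b La]; first by rewrite -mx22_0.
  by have := LD _ _ La Lc; rewrite mx22E addr0.
by have := LZ t _ La; rewrite mx22E mulr0.
Qed.

Lemma low_kind_exists L : lie_set L -> L `<=` lowL plane -> (exists2 X, L X & X != 0) ->
  exists k g, lower_unit g /\ conj_set g L = low_kind_L k.
Proof.
move=> Llie Llow [X0 LX0 X0n].
have [L0 LD LZ LB] := Llie; have WL := lie_set_diag_rel Llie.
have [LN|LN] := pselect (L (mx22 0 0 1 0)).
  (* With E21 in [L] the corner entry is free, and [L] is determined by its diagonal part. *)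
  have -> : L = lowL (fun a b => L (mx22 a 0 0 b)).
    have LNc c : L (mx22 0 0 c 0) by have := LZ c _ LN; rewrite mx22E mulr0 mulr1.
    apply/seteqP; split=> [X LX|_ [a [b [c [Lab ->]]]]].
      have [a [b [c [_ XE]]]] := Llow _ LX; exists a, b, c; split=> //.
      have := LD _ _ LX (LNc (- c)).
      by rewrite XE mx22E !addr0 subrr.
    by have := LD _ _ Lab (LNc c); rewrite mx22E !addr0 add0r.
  have [Wall|[u [v [uv0 WE]]]|W0] := plane_or_line WL.
  - exists LowPlane, 1%:M; split; first exact: lower_unit1.
    by rewrite conj_set1; apply: lowL_ext => a b; split.
  - rewrite (lowL_ext WE); have [E|[la E]] := line_normalize uv0; rewrite (lowL_ext E).
      by exists LowScal, 1%:M; split; [exact: lower_unit1|rewrite conj_set1].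
    by exists (LowLine la), 1%:M; split; [exact: lower_unit1|rewrite conj_set1].
  - exists LowNil, 1%:M; split; first exact: lower_unit1.
    rewrite conj_set1; apply: lowL_ext => a b; rewrite W0.
    by split=> [[-> ->]|[t [-> ->]]]; [exists 0; rewrite mulr0|rewrite mulr0].
have nilL c : L (mx22 0 0 c 0) -> c = 0.
  move=> Lc; apply: contrapT => /eqP c0; apply: LN.
  by have := LZ c^-1 _ Lc; rewrite mx22E mulr0 mulVf.
have [[a [b [c [Labc ab]]]]|scal] :=
  pselect (exists a b c, L (mx22 a 0 c b) /\ a != b).
  have D0 : b - a != 0 by rewrite subr_eq0 eq_sym.
  (* This shear diagonalises the chosen element with distinct diagonal entries. *)
  pose g := mx22 1 0 (c / (b - a)) 1.
  have gl : lower_unit g by exists 1, (c / (b - a)), 1; rewrite oner_neq0.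
  have conjE a' b' c' : g *m mx22 a' 0 c' b' *m invmx g =
      mx22 a' 0 (c / (b - a) * (a' - b') + c') b'.
    by rewrite conj_lower ?oner_neq0//; congr mx22; field.
  have gu := lower_unit_unitmx gl.
  have Clie := lie_set_conj gu Llie; have [_ _ _ CB] := Clie.
  have CX : conj_set g L (mx22 a 0 0 b).
    by exists (mx22 a 0 c b) => //; rewrite conjE; congr mx22; field.
  suff [k kE] : exists k, conj_set g L = low_kind_L k by exists k, g.
  have -> : conj_set g L = diagL (fun a b => conj_set g L (mx22 a 0 0 b)).
    apply/seteqP; split=> [Y CY|_ [a' [b' [Lab ->]]]//].
    have [Z LZ' YE] := CY; have [a' [b' [c' [_ ZE]]]] := Llow _ LZ'.
    rewrite -{}YE {}ZE conjE in CY *; set e := _ + c' in CY *.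
    suff e0 : e = 0 by rewrite e0 in CY *; exists a', b'.
    (* The bracket with the diagonalised element is [(b - a) * e] times E21. It comes from a
       nilpotent element of [L], which must be 0, so the whole conjugate is diagonal. *)
    have [U LU UE] := CB _ _ CX CY; have [a2 [b2 [c2 [_ U2]]]] := Llow _ LU.
    move: UE; rewrite U2 conjE !mx22E => /mx22_inj[a20 _ ec b20].
    have {}a20 : a2 = 0 by rewrite a20; ring.
    have {}b20 : b2 = 0 by rewrite b20; ring.
    rewrite U2 a20 b20 in LU; move: ec; rewrite a20 b20 (nilL _ LU) => ec.
    have /eqP : (b - a) * e = 0 by rewrite -[RHS](mulr0 (c / (b - a))); lra.
    by rewrite mulf_eq0 (negPf D0) => /eqP.
  have [Wall|[u [v [uv0 WE]]]|W0] := plane_or_line (lie_set_diag_rel Clie).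
  - by exists LowDiag; apply: diagL_ext => a' b'; split.
  - rewrite (diagL_ext WE); have [E|[la E]] := line_normalize uv0; last first.
      by exists (LowDiagLine la); rewrite (diagL_ext E).
    (* The line of equal entries is excluded: it would contain (a, b) with a different from b. *)
    have /WE/E[t [ta tb]] := CX.
    by move: ab; rewrite ta tb eqxx.
  - by have /W0[a0 b0] := CX; move: ab; rewrite a0 b0 eqxx.
have {}scal X : L X -> exists a c, X = mx22 a 0 c a.
  move=> LX; have [a [b [c [_ XE]]]] := Llow _ LX; exists a, c.
  rewrite XE; congr mx22; apply/esym/eqP/contraT => ab.
  by case: scal; exists a, b, c; rewrite -XE.
have [a [c X0E]] := scal _ LX0.
have a0 : a != 0.
  apply: contraNneq X0n => a0; rewrite X0E a0 in LX0 *.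
  by rewrite (nilL _ LX0) -mx22_0.
(* Subtracting the multiple of [X0] with the same diagonal leaves a nilpotent element, which is 0;
   so [L] is a line. *)
have LE X : L X <-> exists t, X = t *: X0.
  split=> [LX|[t ->]]; last exact: LZ.
  have [a' [c' XE]] := scal _ LX; exists (a' / a).
  have := LD _ _ LX (LZ (- (a' / a)) _ LX0).
  rewrite XE X0E !mx22E !mulr0 !addr0 mulNr divfK// subrr => /nilL c'E.
  by congr mx22; lra.
have [c0|c0] := eqVneq c 0.
  exists LowHom, 1%:M; split; first exact: lower_unit1.
  rewrite conj_set1; apply/seteqP; split=> [X /LE[t ->]|_ [_ [_ [[t [-> ->]] ->]]]].
    by exists (t * a), (t * a); split;
      [exists (t * a); rewrite mulr1|rewrite X0E c0 mx22E !mulr0].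
  by apply/LE; exists (t / a); rewrite X0E c0 mx22E !mulr0 !mulr1 divfK.
have pl : c / a != 0 by rewrite mulf_neq0 ?invr_eq0.
(* This scaling turns the corner c of [X0] into its diagonal entry a. *)
exists LowUnip, (mx22 (c / a) 0 0 1); split; first by exists (c / a), 0, 1; rewrite oner_neq0.
have cE t : mx22 (c / a) 0 0 1 *m (t *: X0) *m invmx (mx22 (c / a) 0 0 1) =
    mx22 (t * a) 0 (t * a) (t * a).
  rewrite X0E mx22E mulr0 conj_lower ?oner_neq0//; congr mx22; field.
  by rewrite a0 c0.
apply/seteqP; split=> [_ [X /LE[t ->] <-]|_ [t ->]]; first by exists (t * a).
by exists (t / a *: X0); [exact/LE/ex_intro|rewrite cE divfK].
Qed.

End TriangularKinds.


(** * Conformal and diagonal subalgebras, and invariants separating the kinds *)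

Section ConformalAndDiagonalKinds.
Context {R : realType}.
Implicit Types (L : set 'M[R]_2) (a b c d p q r u v la al be : R).

Inductive conf_kind := ConfPlane | ConfLine of R | ConfRot.

Definition conf_kind_L k : set 'M[R]_2 :=
  match k with
  | ConfPlane => confL plane
  | ConfLine al => confL (line 1 al)
  | ConfRot => confL (line 0 1)
  end.

Definition conf_kind_adm k := if k is ConfLine al then 0 <= al else True.

Inductive diag_kind := DiagPlane | DiagLine of R.

Definition diag_kind_L k : set 'M[R]_2 :=
  match k with
  | DiagPlane => diagL plane
  | DiagLine be => diagL (line 1 be)
  end.

Definition diag_kind_adm k := if k is DiagLine be then -1 <= be <= 1 else True.

(** Conjugation by it reverses angles and so changes the sign of al. *)
Definition refl22 : 'M[R]_2 := mx22 1 0 0 (- 1).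
(** Conjugation by it exchanges diagonal entries and so replaces a non-zero ratio by its inverse. *)
Definition swap22 : 'M[R]_2 := mx22 0 1 1 0.

Lemma refl22_unit : refl22 \in unitmx.
Proof. by rewrite mx22_unit mul1r mul0r subr0 oppr_eq0 oner_neq0. Qed.

Lemma swap22_unit : swap22 \in unitmx.
Proof. by rewrite mx22_unit mul1r mul0r sub0r oppr_eq0 oner_neq0. Qed.

Lemma invmx_refl22 : invmx refl22 = refl22.
Proof. by apply: invmx_eq; rewrite mx22E mx22_1; congr mx22; ring. Qed.

Lemma invmx_swap22 : invmx swap22 = swap22.
Proof. by apply: invmx_eq; rewrite mx22E mx22_1; congr mx22; ring. Qed.

Lemma conj_refl22 a b c d : refl22 *m mx22 a b c d *m invmx refl22 = mx22 a (- b) (- c) d.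
Proof. by rewrite invmx_refl22 !mx22E; congr mx22; ring. Qed.

Lemma conj_swap22 a b c d : swap22 *m mx22 a b c d *m invmx swap22 = mx22 d c b a.
Proof. by rewrite invmx_swap22 !mx22E; congr mx22; ring. Qed.

Lemma conf_kind_exists L : lie_set L -> L `<=` confL plane ->
  (exists2 X, L X & X != 0) ->
  exists k g, [/\ g = 1%:M \/ g = refl22, conf_kind_adm k & conj_set g L = conf_kind_L k].
Proof.
move=> [L0 LD LZ _] Lconf [X0 LX0 X0n].
pose W a b := L (mx22 a (- b) b a).
have WL : linear_rel W.
  split=> [|a b c d Wab Wcd|t a b Wab]; rewrite /W; first by rewrite oppr0 -mx22_0.
    by have := LD _ _ Wab Wcd; rewrite mx22E -opprD.
  by have := LZ t _ Wab; rewrite mx22E mulrN.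
have LE : L = confL W.
  apply/seteqP; split=> [X LX|_ [a [b [Wab ->]]]//].
  have [a [b [_ XE]]] := Lconf _ LX; exists a, b; split=> //.
  by rewrite /W -XE.
have [Wall|[u [v [uv0 WE]]]|W0] := plane_or_line WL; rewrite {}LE in LX0 *.
- exists ConfPlane, 1%:M; split; rewrite ?conj_set1; [by left|by []|].
  by apply: confL_ext => a b; split.
- rewrite (confL_ext WE); have [u0|u0] := eqVneq u 0.
    have v0 : v != 0 by apply/eqP => v0; exact: uv0.
    exists ConfRot, 1%:M; split; rewrite ?conj_set1; [by left|by []|].
    apply: confL_ext => a b; rewrite u0; split=> [[t [-> ->]]|[t [-> ->]]].
      by exists (t * v); rewrite !mulr0 mulr1.
    by exists (t / v); rewrite !mulr0 mulr1 divfK.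
  have [vu|vu] := leP 0 (v / u).
    exists (ConfLine (v / u)), 1%:M; split; rewrite ?conj_set1; [by left|by []|].
    apply: confL_ext => a b; split=> [[t [-> ->]]|[t [-> ->]]].
      by exists (t * u); split; field.
    by exists (t / u); split; field.
  exists (ConfLine (- (v / u))), refl22; split; [by right|by rewrite /= oppr_ge0 ltW|].
  apply/seteqP; split=> [_ [_ [_ [_ [[t [-> ->]] ->]]] <-]|_ [_ [_ [[t [-> ->]] ->]]]].
    rewrite conj_refl22; exists (t * u), (- (t * v)); split=> //.
    by exists (t * u); split; field.
  exists (mx22 t (- (t * (v / u))) (t * (v / u)) t); last first.
    by rewrite conj_refl22; congr mx22; ring.
  by exists t, (t * (v / u)); split=> //; exists (t / u); split; field.
- have [a [b [/W0[a0 b0] XE]]] := LX0.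
  by move: X0n; rewrite XE a0 b0 oppr0 -mx22_0 eqxx.
Qed.

(** A generator is divided by its entry of larger modulus, so the other entry lands in [-1, 1]; the
    swap brings the divisor to the first place. *)
Lemma diag_kind_exists L : lie_set L -> L `<=` diagL plane ->
  (exists2 X, L X & X != 0) ->
  exists k g, [/\ g = 1%:M \/ g = swap22, diag_kind_adm k & conj_set g L = diag_kind_L k].
Proof.
move=> Llie Ldiag [X0 LX0 X0n].
have LE : L = diagL (fun a b => L (mx22 a 0 0 b)).
  apply/seteqP; split=> [X LX|_ [a [b [Wab ->]]]//].
  by have [a [b [_ XE]]] := Ldiag _ LX; exists a, b; split=> //; rewrite -XE.
have [Wall|[u [v [uv0 WE]]]|W0] := plane_or_line (lie_set_diag_rel Llie).
- exists DiagPlane, 1%:M; split; rewrite ?conj_set1; [by left|by []|].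
  by rewrite LE; apply: diagL_ext => a b; split.
- have bound (x y : R) : `|y| <= `|x| -> x != 0 -> - 1 <= y / x <= 1.
    by move=> yx x0; rewrite -ler_norml normrM normfV ler_pdivrMr ?normr_gt0// mul1r.
  rewrite LE (diagL_ext WE); have [vu|vu] := leP `|v| `|u|.
    have u0 : u != 0.
      apply/eqP => u0; apply: uv0; split=> //.
      by apply/eqP; rewrite -normr_le0 (le_trans vu)// u0 normr0.
    exists (DiagLine (v / u)), 1%:M; split; rewrite ?conj_set1; [by left|exact: bound|].
    apply: diagL_ext => a b; split=> [[t [-> ->]]|[t [-> ->]]].
      by exists (t * u); split; field.
    by exists (t / u); split; field.
  have v0 : v != 0 by rewrite -normr_gt0 (le_lt_trans _ vu).
  exists (DiagLine (u / v)), swap22; split; [by right|apply: bound => //; exact: ltW|].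
  apply/seteqP; split=> [_ [_ [_ [_ [[t [-> ->]] ->]]] <-]|_ [_ [_ [[t [-> ->]] ->]]]].
    rewrite conj_swap22; exists (t * v), (t * u); split=> //.
    by exists (t * v); split; field.
  exists (mx22 (t * (u / v)) 0 0 t); last by rewrite conj_swap22 mulr1.
  by exists (t * (u / v)), t; split=> //; exists (t / v); split; field.
- rewrite LE in LX0; have [a [b [/W0[a0 b0] XE]]] := LX0.
  by move: X0n; rewrite XE a0 b0 -mx22_0 eqxx.
Qed.

(** [LowScal], [LowUnip] and [LowHom] share one diagonal relation: membership of E21 singles out the
    first, and membership of the identity separates the other two. *)
Definition low_kind_W (k : @low_kind R) : R -> R -> Prop :=
  match k with
  | LowPlane | LowDiag => plane
  | LowLine la | LowDiagLine la => line la (la + 1)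
  | LowNil => line 0 0
  | LowScal | LowUnip | LowHom => line 1 1
  end.

Definition low_kind_nil (k : @low_kind R) : bool :=
  match k with LowPlane | LowLine _ | LowScal | LowNil => true | _ => false end.

Definition low_kind_one (k : @low_kind R) : bool :=
  match k with LowPlane | LowScal | LowDiag | LowHom => true | _ => false end.

Lemma low_kind_WP k a b : low_kind_W k a b <-> exists c, low_kind_L k (mx22 a 0 c b).
Proof.
have lowP W : W a b <-> exists c, lowL W (mx22 a 0 c b).
  split=> [Wab|[c [a' [b' [c' [Wab /mx22_inj[-> _ _ ->]]]]]]//].
  by exists 0, a, b, 0.
have diagP W : W a b <-> exists c, diagL W (mx22 a 0 c b).
  split=> [Wab|[c [a' [b' [Wab /mx22_inj[-> _ _ ->]]]]]//].
  by exists 0, a, b.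
case: k => [|la|||| la||] /=; try exact: lowP; try exact: diagP.
split=> [[t [-> ->]]|[c [t /mx22_inj[-> _ _ ->]]]]; last by exists t; rewrite mulr1.
by rewrite mulr1; exists t, t.
Qed.

Lemma line_succ11 la : ~ line la (la + 1) 1 1.
Proof.
move=> [t [E1 E2]]; have t0 : t = 0 by lra.
by move: E1; rewrite t0 mul0r => /eqP; rewrite oner_eq0.
Qed.

Lemma low_kind_nilP k : low_kind_nil k <-> low_kind_L k (mx22 0 0 1 0).
Proof.
have lowP u v : lowL (line u v) (mx22 0 0 1 0).
  by exists 0, 0, 1; split=> //; exists 0; rewrite !mul0r.
have diagP W : ~ diagL W (mx22 0 0 (1 : R) 0).
  by move=> [a [b [_ /mx22_inj[_ _ /eqP]]]]; rewrite oner_eq0.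
case: k => [|la|||| la||] /=; split=> //; try by move/diagP.
  by move=> _; exists 0, 0, 1.
by move=> [t /mx22_inj[<- _ /eqP]]; rewrite oner_eq0.
Qed.

Lemma low_kind_oneP k : low_kind_one k <-> low_kind_L k (mx22 1 0 0 1).
Proof.
case: k => [|la|||| la||] /=; split=> // H.
- by exists 1, 1, 0.
- by have [a [b [c [Wab /mx22_inj[Ea _ _ Eb]]]]] := H; move: Wab; rewrite -Ea -Eb => /line_succ11.
- by exists 1, 1, 0; split=> //; exists 1; rewrite mulr1.
- have [a [b [c [[t [aE _]] /mx22_inj[/eqP]]]]] := H.
  by rewrite aE mulr0 oner_eq0.
- by exists 1, 1.
- by have [a [b [Wab /mx22_inj[Ea _ _ Eb]]]] := H; move: Wab; rewrite -Ea -Eb => /line_succ11.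
- by have [t /mx22_inj[<- _ /esym/eqP]] := H; rewrite oner_eq0.
- by exists 1, 1; split=> //; exists 1; rewrite mulr1.
Qed.

Lemma low_kindZ (k : @low_kind R) t (X : 'M[R]_2) : low_kind_L k X -> low_kind_L k (t *: X).
Proof.
have lowP W : linear_rel W -> lowL W X -> lowL W (t *: X).
  move=> [_ _ WZ] [a [b [c [Wab ->]]]]; rewrite mx22E mulr0.
  by eexists _, _, _; split; [exact: (WZ t _ _ Wab)|].
have diagP W : linear_rel W -> diagL W X -> diagL W (t *: X).
  move=> [_ _ WZ] [a [b [Wab ->]]]; rewrite mx22E mulr0.
  by eexists _, _; split; [exact: (WZ t _ _ Wab)|].
case: k => [|la|||| la||] /=; try (apply: lowP); try (apply: diagP);
  try exact: plane_linear; try exact: line_linear.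
by move=> [s ->]; exists (t * s); rewrite mx22E mulr0.
Qed.

Lemma low_kind_transfer k k' g : lower_unit g ->
  conj_set g (low_kind_L k) = low_kind_L k' ->
  [/\ forall a b, low_kind_W k a b -> low_kind_W k' a b,
    low_kind_nil k -> low_kind_nil k' & low_kind_one k -> low_kind_one k'].
Proof.
move=> [p [q [r [p0 r0 ->]]]] E; split.
- move=> a b /low_kind_WP[c kc]; apply/low_kind_WP.
  by rewrite -E; eexists; exists (mx22 a 0 c b) => //; rewrite conj_lower.
- move=> /low_kind_nilP kN; apply/low_kind_nilP.
  (* Conjugation multiplies E21 by r / p, so a rescaling is needed. *)
  have -> : mx22 0 0 1 0 = (p / r) *: mx22 0 0 (r / p) 0 :> 'M[R]_2.
    by rewrite mx22E; congr mx22; field; rewrite ?p0 ?r0//.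
  apply: low_kindZ; rewrite -E; exists (mx22 0 0 1 0) => //.
  by rewrite conj_lower//; congr mx22; field.
- move=> /low_kind_oneP k1; apply/low_kind_oneP; rewrite -E.
  exists (mx22 1 0 0 1) => //.
  by rewrite conj_lower//; congr mx22; field.
Qed.

Lemma lower_unitV (g : 'M[R]_2) : lower_unit g -> lower_unit (invmx g).
Proof.
move=> [p [q [r [p0 r0 ->]]]]; rewrite invmx_lower//.
by eexists _, _, _; split; last by []; rewrite invr_eq0.
Qed.

Lemma conj_setK n (g : 'M[R]_n) (S : set 'M[R]_n) : g \in unitmx ->
  conj_set (invmx g) (conj_set g S) = S.
Proof. by move=> gu; rewrite conj_setM ?unitmx_inv// mulVmx// conj_set1. Qed.

Lemma low_kind_inj (k k' : @low_kind R) g : lower_unit g ->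
  conj_set g (low_kind_L k) = low_kind_L k' -> k = k'.
Proof.
move=> gl E; have [W N I] := low_kind_transfer gl E.
have E' : conj_set (invmx g) (low_kind_L k') = low_kind_L k.
  by rewrite -E conj_setK// lower_unit_unitmx.
have {E E'} [W' N' I'] := low_kind_transfer (lower_unitV gl) E'.
have eN : low_kind_nil k = low_kind_nil k' by apply/idP/idP.
have eI : low_kind_one k = low_kind_one k' by apply/idP/idP.
have not10 : ~ line 1 1 1 (0 : R).
  by move=> [t [E1 E2]]; have := @oner_neq0 R; rewrite E1 mulr1 E2 mulr1 eqxx.
have not00 la : ~ line 0 0 la (la + 1) by move=> [t [E1 E2]]; lra.
(* The coordinate difference is 1 on both generators, so the factor between them is 1. *)
have ll la la' : line la' (la' + 1) la (la + 1) -> la = la'.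
  by move=> [t [E1]]; rewrite mulrDr mulr1 -E1 => /addrI t1; rewrite E1 -t1 mul1r.
have l11 : line 1 1 1 (1 : R) by exists 1; rewrite mulr1.
have lla la : line la (la + 1) la (la + 1) by exists 1; rewrite !mul1r.
case: k k' eN eI W W' {N N' I I'} => [|la|||| la||] [|la'|||| la'||] //= _ _ W W'.
- by case: not10; exact: W.
- by congr LowLine; exact/ll/W.
- by case: (not00 la); exact: W.
- by case: not10; exact: W'.
- by case: (not00 la'); exact: W'.
- by case: not10; exact: W.
- by congr LowDiagLine; exact/ll/W.
- by case: (@line_succ11 la); exact: W'.
- by case: (@line_succ11 la'); exact: W.
- by case: not10; exact: W'.
Qed.

(** Invariant under conjugation by any invertible [g], so no information on [g] has to be carried
    along. *)
Definition tr_det_sub L L' := forall X, L X ->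
  exists2 X', L' X' & \tr X = \tr X' /\ \det X = \det X'.

Lemma conj_set_tr_det g L L' : g \in unitmx -> conj_set g L = L' -> tr_det_sub L L'.
Proof.
move=> gu <- X LX; exists (g *m X *m invmx g); first by exists X.
split; first by rewrite mxtrace_mulC mulKmx.
by rewrite !det_mulmx mulrAC -det_mulmx mulmxV// det1 mul1r.
Qed.

Lemma conf_kind_inj k k' g : g \in unitmx -> conf_kind_adm k -> conf_kind_adm k' ->
  conj_set g (conf_kind_L k) = conf_kind_L k' -> k = k'.
Proof.
move=> gu kA kA' E; have T := conj_set_tr_det gu E.
have T' : tr_det_sub (conf_kind_L k') (conf_kind_L k).
  by apply: (@conj_set_tr_det (invmx g)); rewrite ?unitmx_inv// -E conj_setK.
have RP : ~ tr_det_sub (confL plane) (confL (line 0 (1 : R))).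
  move=> /(_ (mx22 1 (- 0) 0 1))[|_ [_ [_ [[t [-> ->]] ->]]] [+ _]]; first by exists 1, 0.
  by rewrite !tr_mx22; lra.
have RL al : ~ tr_det_sub (confL (line 1 al)) (confL (line 0 1)).
  move=> /(_ (mx22 1 (- al) al 1))[|_ [_ [_ [[t [-> ->]] ->]]] [+ _]].
    by exists 1, al; split=> //; exists 1; rewrite !mul1r.
  by rewrite !tr_mx22; lra.
have PL al : ~ tr_det_sub (confL plane) (confL (line 1 al)).
  move=> /(_ (mx22 0 (- 1) 1 0))[|_ [_ [_ [[t [-> ->]] ->]]] []]; first by exists 0, 1.
  rewrite !tr_mx22 !det_mx22 => tE; have -> : t = 0 by lra.
  by rewrite !mul0r; lra.
have LL al al' : 0 <= al -> 0 <= al' ->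
    tr_det_sub (confL (line 1 al)) (confL (line 1 al')) -> al = al'.
  move=> a0 a0' /(_ (mx22 1 (- al) al 1))[|_ [_ [_ [[t [-> ->]] ->]]] []].
    by exists 1, al; split=> //; exists 1; rewrite !mul1r.
  rewrite !tr_mx22 !det_mx22 => tE; have -> : t = 1 by lra.
  rewrite !mul1r => E2; apply/eqP.
  by rewrite -(@eqrXn2 _ 2)//; apply/eqP; rewrite !expr2; lra.
case: k k' {E} kA kA' T T' => [|al|] [|al'|] //=; try by [move=> _ _ /RP|move=> _ _ _ /RP].
- by move=> _ _ /PL.
- by move=> _ _ _ /PL.
- by move=> a0 a0' /(LL _ _ a0 a0') ->.
- by move=> _ _ /RL.
- by move=> _ _ _ /RL.
Qed.

Lemma diag_kind_inj k k' g : g \in unitmx -> diag_kind_adm k -> diag_kind_adm k' ->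
  conj_set g (diag_kind_L k) = diag_kind_L k' -> k = k'.
Proof.
move=> gu kA kA' E; have T := conj_set_tr_det gu E.
have T' : tr_det_sub (diag_kind_L k') (diag_kind_L k).
  by apply: (@conj_set_tr_det (invmx g)); rewrite ?unitmx_inv// -E conj_setK.
have PL be : ~ tr_det_sub (diagL plane) (diagL (line 1 be)).
  (* A singular element of trace 1 forces be = 0, but then the determinant 1 of the identity is out
     of reach. *)
  move=> H; have [|_ [_ [_ [[t [-> ->]] ->]]] []] := H (mx22 1 0 0 0); first by exists 1, 0.
  rewrite !tr_mx22 !det_mx22 => tE dE.
  have [|_ [_ [_ [[s [-> ->]] ->]]] [_]] := H (mx22 1 0 0 1); first by exists 1, 1.
  rewrite !det_mx22 => d1.
  have /eqP : t * (t * be) = 0 by lra.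
  by rewrite !mulf_eq0 => /or3P[] /eqP z0; rewrite z0 in d1 tE; clear -d1 tE; lra.
have LL be be' : -1 <= be <= 1 -> -1 <= be' <= 1 ->
    tr_det_sub (diagL (line 1 be)) (diagL (line 1 be')) -> be = be'.
  move=> /andP[b1 b2] /andP[b1' b2'] /(_ (mx22 1 0 0 be))[|_ [_ [_ [[t [-> ->]] ->]]] []].
    by exists 1, be; split=> //; exists 1; rewrite !mul1r.
  rewrite !tr_mx22 !det_mx22 => tE dE.
  (* 1 is an eigenvalue of the first matrix, hence a root of the common characteristic
     polynomial. *)
  have /eqP : (1 - t) * (1 - t * be') = 0 by clear -tE dE; lra.
  rewrite mulf_eq0 => /orP[] /eqP z0; clear -z0 tE dE b1 b2 b1' b2'.
    have t1 : t = 1 by lra.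
    by rewrite t1 in tE; lra.
  have bt : be = t by lra.
  have bb : be * be' = 1 by rewrite bt; lra.
  (* Given be * be' = 1, these two products are be' - be and be - be'. *)
  have H1 : 0 <= (1 - be) * (1 + be') by apply: mulr_ge0; lra.
  have H2 : 0 <= (1 + be) * (1 - be') by apply: mulr_ge0; lra.
  by lra.
case: k k' {E} kA kA' T T' => [|be] [|be'] //=.
- by move=> _ _ /PL.
- by move=> _ _ _ /PL.
- by move=> b b' /(LL _ _ b b') ->.
Qed.

End ConformalAndDiagonalKinds.

(** * Subspaces of symmetric matrices *)


Section Dagger.
Context {R : realType}.
Implicit Types (g h s : 'M[R]_2) (S : set 'M[R]_2).

Lemma daggerE g s : dagger g s = (invmx g)^T *m s *m invmx g.
Proof. by rewrite /dagger trmx_inv. Qed.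

Lemma dagger1 s : dagger 1%:M s = s.
Proof. by rewrite daggerE invmx1 trmx1 mul1mx mulmx1. Qed.

Lemma daggerM g h s : g \in unitmx -> h \in unitmx ->
  dagger (g *m h) s = dagger g (dagger h s).
Proof.
move=> gu hu; have ghV : invmx (g *m h) = invmx h *m invmx g.
  by apply: invmx_eq; rewrite mulmxA mulmxK// mulmxV.
by rewrite !daggerE ghV trmx_mul !mulmxA.
Qed.

Lemma daggerK g s : g \in unitmx -> dagger (invmx g) (dagger g s) = s.
Proof. by move=> gu; rewrite -daggerM ?unitmx_inv// mulVmx// dagger1. Qed.

Lemma daggerVK g s : g \in unitmx -> dagger g (dagger (invmx g) s) = s.
Proof. by move=> gu; rewrite -daggerM ?unitmx_inv// mulmxV// dagger1. Qed.

Lemma dagger_imageP g S S' : g \in unitmx ->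
  (forall s, S s -> S' (dagger g s)) -> (forall s, S' s -> S (dagger (invmx g) s)) ->
  dagger g @` S = S'.
Proof.
move=> gu SS' S'S; apply/seteqP; split=> [_ [s Ss <-]|s S's]; first exact: SS'.
by exists (dagger (invmx g) s); [exact: S'S|rewrite daggerVK].
Qed.

Lemma dagger_imageM g h S : g \in unitmx -> h \in unitmx ->
  dagger g @` (dagger h @` S) = dagger (g *m h) @` S.
Proof.
move=> gu hu; apply/seteqP; split=> [_ [_ [s Ss <-] <-]|_ [s Ss <-]].
  by exists s => //; rewrite daggerM.
by exists (dagger h s); [exists s|rewrite daggerM].
Qed.

Lemma dagger_imageV g S S' : g \in unitmx -> dagger g @` S = S' ->
  dagger (invmx g) @` S' = S.
Proof.
move=> gu <-; rewrite dagger_imageM ?unitmx_inv// mulVmx//.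
by apply/seteqP; split=> [_ [s Ss <-]|s Ss]; [rewrite dagger1|exists s; rewrite ?dagger1].
Qed.

Lemma sigma_stab_image ty g : g \in unitmx -> stab_alg ty g -> stab_alg ty (invmx g) ->
  dagger g @` sigma_set ty = sigma_set ty.
Proof.
move=> gu Ag Ag'; apply: dagger_imageP => // s; rewrite daggerE; first exact: sigma_stab.
by rewrite invmxK; exact: sigma_stab.
Qed.

Lemma dagger_lower_unit g : lower_unit g -> dagger g @` Sig_e1 = Sig_e1.
Proof.
have lowS h : lower_unit h -> stab_alg TE1 h.
  by move=> [p [q [r [_ _ ->]]]]; exists p, r, q.
move=> gl; apply: (@sigma_stab_image TE1); first exact: lower_unit_unitmx.
  exact: lowS.
by apply: lowS; exact: lower_unitV.
Qed.

Lemma dagger_upper_unit g : lower_unit g^T -> dagger g @` Sig_uv = Sig_uv.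
Proof.
have lowS h : lower_unit h^T -> stab_alg TUV h.
  by move=> [p [q [r [_ _ hE]]]]; exists p, r, q.
move=> gl; apply: (@sigma_stab_image TUV); last 2 first.
- exact: lowS.
- by apply: lowS; rewrite trmx_inv; exact: lower_unitV.
- by rewrite -unitmx_tr lower_unit_unitmx.
Qed.

Lemma dagger_refl22 ty : ty = TScal \/ ty = TTrace0 ->
  dagger refl22 @` sigma_set ty = sigma_set ty :> set 'M[R]_2.
Proof.
move=> tyE; apply: dagger_imageP; rewrite ?refl22_unit//;
  move=> s; rewrite daggerE ?invmxK ?invmx_refl22 /refl22;
  case: tyE => ->; [move=> [u ->]|move=> [u [v ->]]|move=> [u ->]|move=> [u [v ->]]].
- by exists u; rewrite !mx22E; congr mx22; ring.
- by exists u, (- v); rewrite !mx22E; congr mx22; ring.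
- by exists u; rewrite !mx22E; congr mx22; ring.
- by exists u, (- v); rewrite !mx22E; congr mx22; ring.
Qed.

Lemma dagger_swap22 ty : ty = TDiag \/ ty = TAnti ->
  dagger swap22 @` sigma_set ty = sigma_set ty :> set 'M[R]_2.
Proof.
move=> tyE; apply: dagger_imageP; rewrite ?swap22_unit//;
  move=> s; rewrite daggerE ?invmxK ?invmx_swap22 /swap22;
  case: tyE => ->; [move=> [u [v ->]]|move=> [u ->]|move=> [u [v ->]]|move=> [u ->]].
- by exists v, u; rewrite !mx22E; congr mx22; ring.
- by exists u; rewrite !mx22E; congr mx22; ring.
- by exists v, u; rewrite !mx22E; congr mx22; ring.
- by exists u; rewrite !mx22E; congr mx22; ring.
Qed.

(** E11 is sent to the outer square of the first row (a, b) of the inverse, whose last entry b * b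
    has to vanish. This reduces uniqueness over this Sigma to triangular conjugations. *)
Lemma dagger_stab_e1 g : g \in unitmx -> dagger g @` Sig_e1 = Sig_e1 -> lower_unit g.
Proof.
move=> gu gS; rewrite -[g]invmxK; apply: lower_unitV.
have : Sig_e1 (dagger g (mx22 1 0 0 0)) by rewrite -gS; exists (mx22 1 0 0 0) => //; exists 1.
have := gu; rewrite -unitmx_inv daggerE; move: (invmx g) => k.
rewrite [k]mx22_eta; move: (k 0 0) (k 0 1) (k 1 0) (k 1 1) => a b c d.
rewrite mx22_unit => D [u]; rewrite !mx22E => /mx22_inj[_ _ _ E].
have /eqP : b * b = 0 by lra.
rewrite mulf_eq0 orbb => /eqP b0; rewrite b0 mul0r subr0 mulf_eq0 negb_or in D *.
by case/andP: D => a0 d0; exists a, c, d.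
Qed.

Lemma dagger_stab_uv g : g \in unitmx -> dagger g @` Sig_uv = Sig_uv -> lower_unit g^T.
Proof.
move=> gu gS; rewrite -[g]invmxK trmx_inv; apply: lower_unitV.
have : Sig_uv (dagger g (mx22 0 0 0 1)) by rewrite -gS; exists (mx22 0 0 0 1) => //; exists 0, 1.
have := gu; rewrite -unitmx_inv daggerE; move: (invmx g) => k.
rewrite [k]mx22_eta; move: (k 0 0) (k 0 1) (k 1 0) (k 1 1) => a b c d.
rewrite mx22_unit => D [u [v]]; rewrite !mx22E => /mx22_inj[E _ _ _].
have /eqP : c * c = 0 by lra.
rewrite mulf_eq0 orbb => /eqP c0; rewrite c0 mulr0 subr0 mulf_eq0 negb_or in D *.
by case/andP: D => a0 d0; exists a, b, d.
Qed.

(** One or two test elements of Sigma already give enough linear equations on the entries of [X]. *)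
Lemma stab_infinitesimal ty (X : 'M[R]_2) :
  (forall s, sigma_set ty s -> sigma_set ty (X^T *m s + s *m X)) -> stab_alg ty X.
Proof.
rewrite [X]mx22_eta; move: (X 0 0) (X 0 1) (X 1 0) (X 1 1) => a b c d.
case: ty => /= XS.
- have [|u] := XS (mx22 1 0 0 0); first by exists 1.
  rewrite !mx22E => /mx22_inj[_ E _ _].
  by exists a, d, c; split=> //; congr mx22; lra.
- have [|u [v]] := XS (mx22 0 1 1 0); first by exists 1, 0.
  rewrite !mx22E => /mx22_inj[E _ _ _].
  by exists a, d, b; split=> //; rewrite mx22T; congr mx22; lra.
- have [|u] := XS (mx22 1 0 0 1); first by exists 1.
  rewrite !mx22E => /mx22_inj[E1 E2 _ E3].
  by exists a, c; split=> //; congr mx22; lra.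
- have [|u [v]] := XS (mx22 1 0 0 (- 1)); first by exists 1, 0.
  rewrite !mx22E => /mx22_inj[E1 _ _ E2].
  have [|u' [v']] := XS (mx22 0 1 1 0); first by exists 0, 1; rewrite oppr0.
  rewrite !mx22E => /mx22_inj[E3 _ _ E4].
  by exists a, c; split=> //; congr mx22; lra.
- have [|u [v]] := XS (mx22 1 0 0 0); first by exists 1, 0.
  rewrite !mx22E => /mx22_inj[_ E1 _ _].
  have [|u' [v']] := XS (mx22 0 0 0 1); first by exists 0, 1.
  rewrite !mx22E => /mx22_inj[_ E2 _ _].
  by exists a, d; split=> //; congr mx22; lra.
- have [|u] := XS (mx22 0 1 1 0); first by exists 1.
  rewrite !mx22E => /mx22_inj[E1 _ _ E2].
  by exists a, d; split=> //; congr mx22; lra.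
Qed.

End Dagger.

(** * Invariants of the types, and subspaces of three-dimensional space *)

Section SigmaTypes.
Context {R : realType}.
Implicit Types (g h s : 'M[R]_2) (S : set 'M[R]_2) (p q r u v w x y z : R).

(** Whether Sigma contains a definite element, and below, a non-zero singular one. With the
    dimension these two bits separate all six types, and [dagger] respects them as it multiplies
    determinants by a non-zero square. *)
Definition sigma_pos ty : bool := match ty with TScal | TDiag => true | _ => false end.
Definition sigma_null ty : bool := match ty with TE1 | TUV | TDiag => true | _ => false end.

Lemma sigma_posP ty : sigma_pos ty <-> exists2 s : 'M[R]_2, sigma_set ty s & 0 < \det s.
Proof.
split; case: ty => //= H.
- by exists (mx22 1 0 0 1); [exists 1|rewrite det_mx22; lra].
- by exists (mx22 1 0 0 1); [exists 1, 1|rewrite det_mx22; lra].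
- by case: H => _ [u ->]; rewrite det_mx22 => ?; exfalso; lra.
- by case: H => _ [u [v ->]]; rewrite det_mx22 => ?; exfalso; nra.
- by case: H => _ [u [v ->]]; rewrite det_mx22 => ?; exfalso; nra.
- by case: H => _ [u ->]; rewrite det_mx22 => ?; exfalso; nra.
Qed.

Lemma sigma_nullP ty : sigma_null ty <->
  exists s : 'M[R]_2, [/\ sigma_set ty s, s != 0 & \det s = 0].
Proof.
have n1 : (1 : R) != 0 by exact: oner_neq0.
split; case: ty => //= H.
- exists (mx22 1 0 0 0); split; [by exists 1| |by rewrite det_mx22; lra].
  by rewrite mx22_0; apply: contraNneq n1 => /mx22_inj[->].
- exists (mx22 0 0 0 1); split; [by exists 0, 1| |by rewrite det_mx22; lra].
  by rewrite mx22_0; apply: contraNneq n1 => /mx22_inj[_ _ _ ->].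
- exists (mx22 1 0 0 0); split; [by exists 1, 0| |by rewrite det_mx22; lra].
  by rewrite mx22_0; apply: contraNneq n1 => /mx22_inj[->].
- case: H => _ [[u ->]]; rewrite det_mx22 => /eqP s0 D; case: s0.
  by rewrite mx22_0; have -> : u = 0 by nra.
- case: H => _ [[u [v ->]]]; rewrite det_mx22 => /eqP s0 D; case: s0.
  have -> : u = 0 by nra.
  have -> : v = 0 by nra.
  by rewrite mx22_0 oppr0.
- case: H => _ [[u ->]]; rewrite det_mx22 => /eqP s0 D; case: s0.
  by rewrite mx22_0; have -> : u = 0 by nra.
Qed.

Lemma has_dim_unique n (T : set 'M[R]_n) d d' : has_dim T d -> has_dim T d' -> d = d'.
Proof.
move=> [V TV <-] [V' TV' <-]; congr (\dim _); apply/vspaceP => X.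
have /seteqP[VV' V'V] : [set` V] = [set` V'] by rewrite -TV.
by apply/idP/idP; [exact: VV'|exact: V'V].
Qed.

Lemma has_dim_dagger g S d : g \in unitmx -> has_dim S d -> has_dim (dagger g @` S) d.
Proof.
move=> gu [V -> Vd].
pose f := linfun (mulmxr (invmx g) \o mulmx (invmx g)^T : 'M[R]_2 -> 'M[R]_2).
have fE s : f s = dagger g s by rewrite lfunE/= daggerE.
exists (f @: V)%VS.
  apply/seteqP; split=> [_ [s Vs <-]|_ /memv_imgP[s Vs ->]].
    by rewrite /= -fE memv_img.
  by rewrite fE; exists s.
rewrite limg_dim_eq//; apply/eqP; rewrite -subv0; apply/subvP => s.
rewrite memv_cap memv_ker memv0 fE => /andP[_ /eqP ds].
by rewrite -(daggerK s gu) ds daggerE mulmx0 mul0mx.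
Qed.

Lemma det_dagger g s : \det (dagger g s) = \det s * (\det (invmx g)) ^+ 2.
Proof. by rewrite daggerE !det_mulmx det_tr; ring. Qed.

Lemma dagger_sigma_sub ty ty' g : g \in unitmx -> dagger g @` sigma_set ty = sigma_set ty' ->
  (sigma_pos ty -> sigma_pos ty') /\ (sigma_null ty -> sigma_null ty').
Proof.
move=> gu E; have gV0 : \det (invmx g) != 0 by rewrite -unitfE -unitmxE unitmx_inv.
split=> [/sigma_posP[s sS s0]|/sigma_nullP[s [sS s0 sd]]].
  apply/sigma_posP; exists (dagger g s); first by rewrite -E; exists s.
  by rewrite det_dagger mulr_gt0// exprn_even_gt0.
apply/sigma_nullP; exists (dagger g s); split; first by rewrite -E; exists s.
  apply: contraNneq s0 => ds; rewrite -(daggerK s gu) ds daggerE.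
  by rewrite mulmx0 mul0mx.
by rewrite det_dagger sd mul0r.
Qed.

Lemma sigma_type_unique ty ty' g : g \in unitmx ->
  dagger g @` sigma_set ty = sigma_set ty' -> ty = ty'.
Proof.
move=> gu E; have [pos null] := dagger_sigma_sub gu E.
have gVu : invmx g \in unitmx by rewrite unitmx_inv.
have [pos' null'] := dagger_sigma_sub gVu (dagger_imageV gu E).
have := has_dim_dagger gu (has_dim_sigma ty); rewrite E => /has_dim_unique.
move=> /(_ _ (has_dim_sigma ty')).
have {pos pos'} : sigma_pos ty = sigma_pos ty' by apply/idP/idP.
have {null null'} : sigma_null ty = sigma_null ty' by apply/idP/idP.
by case: ty ty' {E} => [] [].
Qed.

(** A linear subspace of R^3, to be read as coordinates (p, q, r) of [mx22 p q q r]. *)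
Record linear_rel3 (W : R -> R -> R -> Prop) : Prop := LinearRel3 {
  rel3_0 : W 0 0 0;
  rel3_D : forall p q r x y z, W p q r -> W x y z -> W (p + x) (q + y) (r + z);
  rel3_Z : forall t p q r, W p q r -> W (t * p) (t * q) (t * r) }.

Lemma sum_sqr3_eq0 x y z : x * x + y * y + z * z = 0 -> [/\ x = 0, y = 0 & z = 0].
Proof. by move=> E; split; nra. Qed.

(* In the plane case the coordinates on two spanning vectors u and v are given by
   Cramer's rule, with the cross product of u and v as third basis vector. *)
Lemma linear_rel3_cases W : linear_rel3 W ->
  [\/ forall p q r, W p q r -> [/\ p = 0, q = 0 & r = 0],
     exists x y z, ~ [/\ x = 0, y = 0 & z = 0] /\
       forall p q r, W p q r <-> exists t, [/\ p = t * x, q = t * y & r = t * z],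
     exists x y z, ~ [/\ x = 0, y = 0 & z = 0] /\
       forall p q r, W p q r <-> p * x + q * y + r * z = 0 |
     forall p q r, W p q r].
Proof.
move=> [W0 WD WZ].
have [[u1 [u2 [u3 [Wu u0]]]]|noW] :=
    pselect (exists x y z, W x y z /\ ~ [/\ x = 0, y = 0 & z = 0]); last first.
  apply: Or41 => p q r Wp; apply: contrapT => p0; apply: noW.
  by exists p, q, r.
have uu0 : u1 * u1 + u2 * u2 + u3 * u3 != 0.
  by apply/eqP => /sum_sqr3_eq0.
pose n1 v2 v3 := u2 * v3 - u3 * v2.
pose n2 v1 v3 := u3 * v1 - u1 * v3.
pose n3 v1 v2 := u1 * v2 - u2 * v1.
have [[v1 [v2 [v3 [Wv n0]]]]|prop] := pselect (exists v1 v2 v3, W v1 v2 v3 /\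
    n1 v2 v3 * n1 v2 v3 + n2 v1 v3 * n2 v1 v3 + n3 v1 v2 * n3 v1 v2 != 0); last first.
  apply: Or42; exists u1, u2, u3; split=> // p q r.
  split=> [Wp|[t [-> -> ->]]]; last exact: WZ.
  have /sum_sqr3_eq0[c1 c2 c3] :
      n1 q r * n1 q r + n2 p r * n2 p r + n3 p q * n3 p q = 0.
    by apply/eqP; apply: contraT => c0; case: prop; exists p, q, r.
  (* The coefficient of the orthogonal projection on u; it is exact because the cross product with u
     vanishes. *)
  exists ((p * u1 + q * u2 + r * u3) / (u1 * u1 + u2 * u2 + u3 * u3)).
  rewrite /n1 /n2 /n3 in c1 c2 c3.
  split; rewrite mulrAC; apply: (mulIf uu0); rewrite divfK//.
  - transitivity ((p * u1 + q * u2 + r * u3) * u1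
      + (u3 * (u3 * p - u1 * r) - u2 * (u1 * q - u2 * p))); first by ring.
    by rewrite c2 c3; ring.
  - transitivity ((p * u1 + q * u2 + r * u3) * u2
      + (u1 * (u1 * q - u2 * p) - u3 * (u2 * r - u3 * q))); first by ring.
    by rewrite c3 c1; ring.
  - transitivity ((p * u1 + q * u2 + r * u3) * u3
      + (u2 * (u2 * r - u3 * q) - u1 * (u3 * p - u1 * r))); first by ring.
    by rewrite c1 c2; ring.
have n0' : ~ [/\ n1 v2 v3 = 0, n2 v1 v3 = 0 & n3 v1 v2 = 0].
  by move=> [e1 e2 e3]; move: n0; rewrite e1 e2 e3 !mulr0 !addr0 eqxx.
move: n0 n0'; set x := n1 _ _; set y := n2 _ _; set z := n3 _ _ => n0 n0'.
pose N := x * x + y * y + z * z; rewrite -/N in n0.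
have perp p q r : p * x + q * y + r * z = 0 -> W p q r.
  move=> pn.
  pose A := ((q * v3 - r * v2) * x + (r * v1 - p * v3) * y + (p * v2 - q * v1) * z) / N.
  pose B := ((u2 * r - u3 * q) * x + (u3 * p - u1 * r) * y + (u1 * q - u2 * p) * z) / N.
  have := WD _ _ _ _ _ _ (WZ A _ _ _ Wu) (WZ B _ _ _ Wv).
  (* In each coordinate the defect is a multiple of the scalar product of (p, q, r) with the normal,
     which is 0. *)
  have key (a b c d e n : R) : a * N - (b * d + c * e) = (p * x + q * y + r * z) * n ->
      b / N * d + c / N * e = a.
    rewrite pn mul0r => /eqP; rewrite subr_eq0 => /eqP E; apply: (mulIf n0).
    by rewrite mulrDl mulrAC divfK// -!mulrA mulrCA [X in _ + X]mulrCA; rewrite E; field.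
  by congr W; [apply: (key _ _ _ _ _ x)|apply: (key _ _ _ _ _ y)|apply: (key _ _ _ _ _ z)];
    rewrite /N /x /y /z /n1 /n2 /n3; ring.
have [[w1 [w2 [w3 [Ww wn]]]]|allperp] :=
    pselect (exists w1 w2 w3, W w1 w2 w3 /\ w1 * x + w2 * y + w3 * z != 0); last first.
  apply: Or43; exists x, y, z; split=> // p q r; split=> [Wp|]; last exact: perp.
  by apply/eqP; apply: contraT => c0; case: allperp; exists p, q, r.
apply: Or44 => p q r.
(* Subtracting t times w makes the vector orthogonal to the normal, so [perp] applies to the
   rest. *)
pose t := (p * x + q * y + r * z) / (w1 * x + w2 * y + w3 * z).
have := WD _ _ _ _ _ _ (perp (p - t * w1) (q - t * w2) (r - t * w3) _) (WZ t _ _ _ Ww).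
rewrite !subrK; apply.
transitivity ((p * x + q * y + r * z) - t * (w1 * x + w2 * y + w3 * z)); first by ring.
by rewrite /t divfK// subrr.
Qed.

End SigmaTypes.


(** * Normal forms of subspaces under congruence *)

Section SigmaNormalForm.
Context {R : realType}.
Implicit Types (g h s : 'M[R]_2) (p q r u v w x y z c : R).

Definition congruent s s' := exists2 g, g \in unitmx & g *m s *m g^T = s'.

Lemma congruent_trans s s' s'' : congruent s s' -> congruent s' s'' -> congruent s s''.
Proof.
move=> [g gu <-] [h hu <-]; exists (h *m g); first by rewrite unitmx_mul hu.
by rewrite trmx_mul !mulmxA.
Qed.

(** The scale and sign of c stay free, since only the line of [s] or its orthogonal complement will
    matter. *)
Definition normal_sym s := exists2 c, c != 0 &
  [\/ s = mx22 c 0 0 0, s = mx22 c 0 0 c | s = mx22 0 c c 0].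

Lemma congruent_diag_normal p d : p != 0 ->
  exists2 s, congruent (mx22 p 0 0 d) s & normal_sym s.
Proof.
move=> p0; have [d0|d0] := eqVneq d 0.
  exists (mx22 p 0 0 d); last by exists p => //; rewrite d0; apply: Or31.
  by exists 1%:M; rewrite ?unitmx1// trmx1 mul1mx mulmx1.
(* Scaling the second coordinate by k gives both diagonal entries the same modulus. *)
pose k := Num.sqrt `|p / d|.
have kk : k * k = `|p / d| by rewrite -expr2 sqr_sqrtr.
have k0 : k != 0 by rewrite gt_eqF// sqrtr_gt0 normr_gt0 mulf_neq0// invr_eq0.
have kC : congruent (mx22 p 0 0 d) (mx22 p 0 0 (k * k * d)).
  exists (mx22 1 0 0 k); first by rewrite mx22_unit mul1r mulr0 subr0.
  by rewrite !mx22E; congr mx22; ring.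
have [pd|pd] := leP 0 (p / d).
  exists (mx22 p 0 0 (k * k * d)) => //; exists p => //; apply: Or32.
  by rewrite kk ger0_norm// divfK.
exists (mx22 0 (p + p) (p + p) 0); last first.
  exists (p + p); last exact: Or33.
  by rewrite -mulr2n mulrn_eq0.
apply: congruent_trans kC _; rewrite kk ltr0_norm// mulNr divfK//.
(* Opposite signs: passing to the isotropic directions makes the form antidiagonal. *)
exists (mx22 1 1 1 (- 1)).
  by rewrite mx22_unit; apply/eqP; lra.
by rewrite !mx22E; congr mx22; ring.
Qed.

Lemma congruent_normal p q r : ~ [/\ p = 0, q = 0 & r = 0] ->
  exists2 s, congruent (mx22 p q q r) s & normal_sym s.
Proof.
have pC x y z : x != 0 -> exists2 s, congruent (mx22 x y y z) s & normal_sym s.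
  move=> x0; have [s sC sN] := congruent_diag_normal (z - y * y / x) x0.
  exists s => //; apply: congruent_trans sC.
  (* Completing the square. *)
  exists (mx22 1 0 (- y / x) 1); first by rewrite mx22_unit mulr1 mul0r subr0 oner_neq0.
  by rewrite !mx22E; congr mx22; field.
move=> n0; have [p0|p0] := eqVneq p 0; last exact: pC.
have [r0|r0] := eqVneq r 0; last first.
  have [s sC sN] := pC r q p r0; exists s => //; apply: congruent_trans sC.
  exists swap22; first exact: swap22_unit.
  by rewrite !mx22E; congr mx22; ring.
exists (mx22 0 q q 0); last first.
  exists q; last exact: Or33.
  by apply/eqP => q0; apply: n0.
by exists 1%:M; rewrite ?unitmx1// trmx1 mul1mx mulmx1 p0 r0.
Qed.

Lemma Sym2_mx22 s : Sym2 s -> s = mx22 (s 0 0) (s 0 1) (s 0 1) (s 1 1).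
Proof.
move=> sT; rewrite [LHS]mx22_eta; congr mx22.
by have /matrixP/(_ 0 1) := sT; rewrite mxE.
Qed.

Lemma sigma_normal_form (V : {vspace 'M[R]_2}) : V != 0%VS -> [set` V] `<` Sym2 ->
  exists ty g, g \in unitmx /\ dagger g @` [set` V] = sigma_set ty.
Proof.
move=> V0 [VSym Vn].
pose W p q r := mx22 p q q r \in V.
have WV s : s \in V -> W (s 0 0) (s 0 1) (s 1 1).
  by move=> sV; rewrite /W -Sym2_mx22//; exact: VSym.
have WL : linear_rel3 W.
  split=> [|p q r x y z Wp Wx|t p q r Wp]; rewrite /W; first by rewrite -mx22_0 mem0v.
    by rewrite -mx22D memvD.
  by rewrite -mx22Z memvZ.
have [W0|[x [y [z [n0 WE]]]]|[x [y [z [n0 WE]]]]|Wall] := linear_rel3_cases WL.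
- case/negP: V0; rewrite -subv0; apply/subvP => s sV; rewrite memv0.
  have [s00 s01 s11] := W0 _ _ _ (WV _ sV).
  by rewrite (Sym2_mx22 (VSym _ sV)) s00 s01 s11 -mx22_0.
- have [s [g gu gs] [c c0 sN]] := congruent_normal n0.
  have gTu : invmx g^T \in unitmx by rewrite unitmx_inv unitmx_tr.
  (* [dagger] of the inverse transpose of [g] is congruence by [g]. *)
  have dE t : dagger (invmx g^T) (t *: mx22 x y y z) = t *: s.
    by rewrite daggerE invmxK trmxK -scalemxAr -scalemxAl gs.
  have VE : [set` V] = [set t *: mx22 x y y z | t in [set: R]].
    apply/seteqP; split=> [s' s'V|_ [t _ <-]] /=.
      have /WE[t [s00 s01 s11]] := WV _ s'V; exists t => //.
      by rewrite (Sym2_mx22 (VSym _ s'V)) s00 s01 s11 mx22Z.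
    by rewrite memvZ//; apply/WE; exists 1; rewrite !mul1r.
  have dV : dagger (invmx g^T) @` [set` V] = [set t *: s | t in [set: R]].
    rewrite VE; apply/seteqP; split=> [_ [_ [t _ <-] <-]|_ [t _ <-]].
      by exists t => //; rewrite dE.
    by exists (t *: mx22 x y y z); [exists t|rewrite dE].
  case: sN => sE; [exists TE1|exists TScal|exists TAnti]; exists (invmx g^T); split=> //;
    rewrite dV sE; apply/seteqP;
    (split=> [_ [t _ <-]|_ [u ->]]; [exists (t * c)|exists (u / c)] => //;
      rewrite mx22Z ?mulr0// divfK//).
(* Halved because the trace of a product of symmetric matrices counts the off-diagonal entry
   twice. *)
- pose tau := mx22 x (y / 2) (y / 2) z.
  have n0' : ~ [/\ x = 0, y / 2 = 0 & z = 0].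
    by move=> [x0 y0 z0]; apply: n0; split=> //; lra.
  have [s [g gu gs] [c c0 sN]] := congruent_normal n0'.
  have VE s' : s' \in V <-> Sym2 s' /\ \tr (s' *m tau) = 0.
    have trE : Sym2 s' -> \tr (s' *m tau) = s' 0 0 * x + s' 0 1 * y + s' 1 1 * z.
      by move=> /Sym2_mx22 ->; rewrite !mx22E tr_mx22 !mxE/=; field.
    split=> [s'V|[s'S]].
      split; first exact: VSym.
      by rewrite trE ?(WE _ _ _).1 ?WV//; exact: VSym.
    by rewrite trE// => /WE; rewrite /W -Sym2_mx22.
  (* [dagger g] is dual to congruence by [g] for the trace form, so normalising [tau] normalises its
     orthogonal complement. *)
  have trE s' : \tr (dagger g s' *m s) = \tr (s' *m tau).
    rewrite -gs daggerE !mulmxA mulmxKV// mxtrace_mulC !mulmxA -trmx_mul mulVmx//.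
    by rewrite trmx1 mul1mx.
  have dSym h s' : Sym2 s' -> Sym2 (dagger h s').
    by rewrite /Sym2/= daggerE !trmx_mul trmxK => ->; rewrite mulmxA.
  have dV : dagger g @` [set` V] = [set s' | Sym2 s' /\ \tr (s' *m s) = 0].
    apply: dagger_imageP => // s' /=.
      by move=> /VE[s'S s'0]; split; [exact: dSym|rewrite trE].
    move=> [s'S s'0]; apply/VE; split; first exact: dSym.
    by rewrite -trE daggerVK.
  have cz w : w * c = 0 -> w = 0.
    by move/eqP; rewrite mulf_eq0 (negPf c0) orbF => /eqP.
  case: sN => sE; [exists TUV|exists TTrace0|exists TDiag]; exists g; split=> //;
    rewrite dV sE; apply/seteqP; split=> [s' [/Sym2_mx22 ->]|_ [u [v ->]]] /=.
  - rewrite !mx22E tr_mx22 => E; exists (s' 0 1), (s' 1 1).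
    by congr mx22; apply: cz; clear -E; lra.
  - by rewrite /Sym2/= !mx22E tr_mx22; split=> //; lra.
  - rewrite !mx22E tr_mx22 => E; exists (s' 0 0), (s' 0 1).
    congr mx22; have : s' 0 0 + s' 1 1 = 0 by apply: cz; clear -E; lra.
    by move=> ?; lra.
  - by rewrite /Sym2/= !mx22E tr_mx22; split=> //; lra.
  - rewrite !mx22E tr_mx22 => E; exists (s' 0 0), (s' 1 1).
    by congr mx22; apply: cz; clear -E; lra.
  - by rewrite /Sym2/= !mx22E tr_mx22; split=> //; lra.
- by case: Vn => s /Sym2_mx22 ->; exact: Wall.
Qed.

End SigmaNormalForm.

(** * Conjugacy of semidirect products *)


Section ConjugateGroups.
Context {R : realType}.
Implicit Types (g h s : 'M[R]_2) (S H L : set 'M[R]_2).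

Lemma conj_semidirect g S H : g \in unitmx -> H `<=` GL R 2 ->
  conj_set (embGL g) (semidirect S H) = semidirect (dagger g @` S) (conj_set g H).
Proof.
move=> gu HGL; apply/seteqP; split=> [_ [_ [s [h [Ss Hh ->]]] <-]|].
  exists (dagger g s), (g *m h *m invmx g); split; [by exists s|by exists h|].
  by rewrite embGL_conj//; exact: HGL.
move=> _ [_ [_ [[s Ss <-] [h Hh <-] ->]]]; exists (Qelt s h); first by exists s, h.
by rewrite embGL_conj//; exact: HGL.
Qed.

(** The two factors are read off the elements (s, 1) and (0, h). *)
Lemma semidirect_inj S H S' H' : S 0 -> S' 0 -> H 1%:M -> H' 1%:M ->
  H `<=` GL R 2 -> semidirect S H = semidirect S' H' -> S = S' /\ H = H'.
Proof.
have sub S1 H1 S2 H2 : S1 0 -> H1 1%:M -> H1 `<=` GL R 2 ->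
    semidirect S1 H1 `<=` semidirect S2 H2 -> S1 `<=` S2 /\ H1 `<=` H2.
  move=> S0 H01 HGL E; split=> [s S1s|h H1h].
    have [s' [h' [S2s' _]]]
      := E (Qelt s 1%:M) (ex_intro _ s (ex_intro _ 1%:M (And3 S1s H01 erefl))).
    by move=> /(@eq_block_mx _ 2 2 2 2)[<- _ + _]; rewrite !mulmx1 => ->.
  have [s' [h' [_ H2h']]] := E (Qelt 0 h) (ex_intro _ 0 (ex_intro _ h (And3 S0 H1h erefl))).
  by move=> /(@eq_block_mx _ 2 2 2 2)[-> _ _ _].
move=> S0 S0' H1 H1' HGL E.
have HGL' : H' `<=` GL R 2.
  move=> h' Hh'; have : semidirect S' H' (Qelt 0 h') by exists 0, h'.
  rewrite -E => -[s [h [_ Hh]]] /(@eq_block_mx _ 2 2 2 2)[-> _ _ _]; exact: HGL.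
have [SS' HH'] : S `<=` S' /\ H `<=` H' by apply: sub => //; rewrite E.
have [S'S H'H] : S' `<=` S /\ H' `<=` H by apply: sub => //; rewrite E.
by split; apply/seteqP.
Qed.

(** Each list of kinds is used twice, for two types with the same or transposed stabilizer: [TE1]
    and [TUV], [TScal] and [TTrace0], [TDiag] and [TAnti]. *)
Definition e1_member (k : @low_kind R) : member R :=
  match k with
  | LowPlane => b2 | LowLine la => c4 la | LowScal => c6 | LowNil => d4
  | LowDiag => c5 | LowDiagLine la => d3 la | LowUnip => d5 | LowHom => d6
  end.

Definition uv_member (k : @low_kind R) : member R :=
  match k with
  | LowPlane => a1 | LowLine la => b3 la | LowScal => b5 | LowNil => c8
  | LowDiag => b4 | LowDiagLine la => c7 la | LowUnip => c9 | LowHom => c10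
  end.

Definition scal_member (k : @conf_kind R) : member R :=
  match k with ConfPlane => c1 | ConfLine al => d1 al | ConfRot => d2 end.

Definition trace0_member (k : @conf_kind R) : member R :=
  match k with ConfPlane => b1 | ConfLine al => c2 al | ConfRot => c3 end.

Definition diag_member (k : @diag_kind R) : member R :=
  match k with DiagPlane => b6 | DiagLine be => c12 be end.

Definition anti_member (k : @diag_kind R) : member R :=
  match k with DiagPlane => c11 | DiagLine be => d7 be end.

Lemma trset_diagL W : trset (diagL W) = diagL W :> set 'M[R]_2.
Proof.
apply/seteqP; split=> X [a [b [Wab XE]]]; exists a, b; split=> //.
  by rewrite -[LHS]trmxK XE mx22T.
by rewrite XE mx22T.
Qed.

Lemma e1_memberP m : member_type m = TE1 -> exists k, m = e1_member k.
Proof.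
case: m => // *;
by first [exact: (ex_intro _ LowPlane erefl)|exact: (ex_intro _ (LowLine _) erefl)
  |exact: (ex_intro _ LowScal erefl)|exact: (ex_intro _ LowNil erefl)
  |exact: (ex_intro _ LowDiag erefl)|exact: (ex_intro _ (LowDiagLine _) erefl)
  |exact: (ex_intro _ LowUnip erefl)|exact: (ex_intro _ LowHom erefl)].
Qed.

Lemma uv_memberP m : member_type m = TUV -> exists k, m = uv_member k.
Proof.
case: m => // *;
by first [exact: (ex_intro _ LowPlane erefl)|exact: (ex_intro _ (LowLine _) erefl)
  |exact: (ex_intro _ LowScal erefl)|exact: (ex_intro _ LowNil erefl)
  |exact: (ex_intro _ LowDiag erefl)|exact: (ex_intro _ (LowDiagLine _) erefl)
  |exact: (ex_intro _ LowUnip erefl)|exact: (ex_intro _ LowHom erefl)].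
Qed.

Lemma scal_memberP m : member_type m = TScal -> exists k, m = scal_member k.
Proof.
case: m => // *; by first [exact: (ex_intro _ ConfPlane erefl)
  |exact: (ex_intro _ (ConfLine _) erefl)|exact: (ex_intro _ ConfRot erefl)].
Qed.

Lemma trace0_memberP m : member_type m = TTrace0 -> exists k, m = trace0_member k.
Proof.
case: m => // *; by first [exact: (ex_intro _ ConfPlane erefl)
  |exact: (ex_intro _ (ConfLine _) erefl)|exact: (ex_intro _ ConfRot erefl)].
Qed.

Lemma diag_memberP m : member_type m = TDiag -> exists k, m = diag_member k.
Proof.
case: m => // *; by first [exact: (ex_intro _ DiagPlane erefl)
  |exact: (ex_intro _ (DiagLine _) erefl)].
Qed.

Lemma anti_memberP m : member_type m = TAnti -> exists k, m = anti_member k.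
Proof.
case: m => // *; by first [exact: (ex_intro _ DiagPlane erefl)
  |exact: (ex_intro _ (DiagLine _) erefl)].
Qed.

Lemma e1_member_L k : member_L (e1_member k) = low_kind_L k.
Proof. by case: k. Qed.

Lemma uv_member_L k : member_L (uv_member k) = trset (low_kind_L k).
Proof. by case: k => //= *; rewrite trset_diagL. Qed.

(** The normalising matrix can always be taken to preserve Sigma, so the earlier normalisation of
    Sigma is not undone. *)
Lemma classify_algebra ty L : lie_set L -> L `<=` stab_alg ty ->
  (exists2 X, L X & X != 0) ->
  exists m g, [/\ g \in unitmx, admissible m, member_type m = ty,
    dagger g @` sigma_set ty = sigma_set ty & conj_set g L = member_L m].
Proof.
move=> Llie Lsub [X0 LX0 X0n].
have LX : exists2 X, L X & X != 0 by exists X0.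
have dag1 S : dagger 1%:M @` S = S.
  by apply/seteqP; split=> [_ [s Ss <-]|s Ss]; [|exists s]; rewrite ?dagger1.
case: ty Lsub => /= Lsub.
- have [k [g [gl gL]]] := low_kind_exists Llie Lsub LX.
  exists (e1_member k), g; split; rewrite ?e1_member_L//; try by case: (k).
    exact: lower_unit_unitmx.
  exact: dagger_lower_unit.
(* Transposition exchanges upper and lower triangular subalgebras. *)
- have [||k [g [gl gL]]] := low_kind_exists (lie_set_trset Llie).
  + by move=> X /Lsub; rewrite /trset/= trmxK.
  + by exists X0^T; rewrite /trset/= ?trmxK// trmx_eq0.
  have gu := lower_unit_unitmx gl.
  exists (uv_member k), (invmx g^T); split; rewrite ?uv_member_L//; try by case: (k).
  + by rewrite unitmx_inv unitmx_tr.
  + by apply: dagger_upper_unit; rewrite trmx_inv trmxK; exact: lower_unitV.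
  + by rewrite -gL conj_set_trset// trsetK.
- have [k [g [gE kA gL]]] := conf_kind_exists Llie Lsub LX.
  exists (scal_member k), g; split; last by rewrite gL; case: (k).
  + by case: gE => ->; [exact: unitmx1|exact: refl22_unit].
  + by case: (k) kA.
  + by case: (k).
  + by case: gE => ->; [exact: dag1|exact: (@dagger_refl22 _ TScal (or_introl erefl))].
- have [k [g [gE kA gL]]] := conf_kind_exists Llie Lsub LX.
  exists (trace0_member k), g; split; last by rewrite gL; case: (k).
  + by case: gE => ->; [exact: unitmx1|exact: refl22_unit].
  + by case: (k) kA.
  + by case: (k).
  + by case: gE => ->; [exact: dag1|exact: (@dagger_refl22 _ TTrace0 (or_intror erefl))].
- have [k [g [gE kA gL]]] := diag_kind_exists Llie Lsub LX.
  exists (diag_member k), g; split; last by rewrite gL; case: (k).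
  + by case: gE => ->; [exact: unitmx1|exact: swap22_unit].
  + by case: (k) kA.
  + by case: (k).
  + by case: gE => ->; [exact: dag1|exact: (@dagger_swap22 _ TDiag (or_introl erefl))].
- have [k [g [gE kA gL]]] := diag_kind_exists Llie Lsub LX.
  exists (anti_member k), g; split; last by rewrite gL; case: (k).
  + by case: gE => ->; [exact: unitmx1|exact: swap22_unit].
  + by case: (k) kA.
  + by case: (k).
  + by case: gE => ->; [exact: dag1|exact: (@dagger_swap22 _ TAnti (or_intror erefl))].
Qed.

(** Equality of types comes from Sigma alone. In the triangular cases preserving Sigma also forces
    [g] to be triangular, as the invariants there require. *)
Lemma member_inj m m' g : g \in unitmx -> admissible m -> admissible m' ->
  dagger g @` member_Sigma m = member_Sigma m' ->
  conj_set g (member_L m) = member_L m' -> m = m'.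
Proof.
move=> gu; rewrite !member_SigmaE => mA mA' /[dup] /(sigma_type_unique gu) ty.
rewrite -ty => gS gL; move/esym: ty.
case tE: (member_type m) gS => /= gS tE'.
- have [k mE] := e1_memberP tE; have [k' mE'] := e1_memberP tE'.
  move: gL; rewrite mE mE' !e1_member_L.
  by move/(low_kind_inj (dagger_stab_e1 gu gS)) ->.
- have [k mE] := uv_memberP tE; have [k' mE'] := uv_memberP tE'.
  move: gL; rewrite mE mE' !uv_member_L conj_set_trset// => /(congr1 trset).
  rewrite !trsetK; have := dagger_stab_uv gu gS => /lower_unitV gl.
  by move/(low_kind_inj gl) ->.
- have [k mE] := scal_memberP tE; have [k' mE'] := scal_memberP tE'.
  move: gL mA mA'; rewrite {}mE {}mE' => gL mA mA'; congr scal_member.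
  by apply: (conf_kind_inj gu); [case: (k) mA|case: (k') mA'|case: (k) (k') gL => [|?|] []].
- have [k mE] := trace0_memberP tE; have [k' mE'] := trace0_memberP tE'.
  move: gL mA mA'; rewrite {}mE {}mE' => gL mA mA'; congr trace0_member.
  by apply: (conf_kind_inj gu); [case: (k) mA|case: (k') mA'|case: (k) (k') gL => [|?|] []].
- have [k mE] := diag_memberP tE; have [k' mE'] := diag_memberP tE'.
  move: gL mA mA'; rewrite {}mE {}mE' => gL mA mA'; congr diag_member.
  by apply: (diag_kind_inj gu); [case: (k) mA|case: (k') mA'|case: (k) (k') gL => [|?] []].
- have [k mE] := anti_memberP tE; have [k' mE'] := anti_memberP tE'.
  move: gL mA mA'; rewrite {}mE {}mE' => gL mA mA'; congr anti_member.
  by apply: (diag_kind_inj gu); [case: (k) mA|case: (k') mA'|case: (k) (k') gL => [|?] []].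
Qed.

Lemma member_Sigma0 m : @member_Sigma R m 0.
Proof.
have [V VE _] := has_dim_sigma (R := R) (member_type m).
by rewrite member_SigmaE VE /= mem0v.
Qed.

Lemma member_group_inj m m' : admissible m -> admissible m' ->
  @conjugate_GL2 R (member_group m) (member_group m') -> m = m'.
Proof.
move=> mA mA' [g gu]; rewrite /GL/= in gu.
have [[mGL m1 _ _] _] := exp_generated_member m.
have [[mGL' m1' _ _] _] := exp_generated_member m'.
rewrite /member_group conj_semidirect// => E.
have [|||||gS gH] := semidirect_inj _ _ _ _ _ E.
- by exists 0; [exact: member_Sigma0|rewrite daggerE mulmx0 mul0mx].
- exact: member_Sigma0.
- by exists 1%:M => //; rewrite mulmx1 mulmxV.
- exact: m1'.
- move=> _ [h /mGL hu <-]; rewrite /GL/= in hu *.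
  by rewrite !unitmx_mul gu hu unitmx_inv.
apply: (@member_inj m m' g) => //.
by rewrite -!lie_algebra_member -gH lie_algebra_conj.
Qed.

(** Congruence of [s] by the exponential of [t *: X] is a curve in Sigma; its velocity at 0 is the
    infinitesimal condition. *)
Lemma lie_algebra_stab ty H :
  (forall h s, H h -> sigma_set ty s -> sigma_set ty (dagger h s)) ->
  lie_algebra H `<=` stab_alg ty.
Proof.
move=> HS X HX; apply: stab_infinitesimal => s sS.
have [V VE _] := has_dim_sigma (R := R) ty.
have D := mx_derivM (mx_derivMr s (mx_derivT (mx_deriv_expmx0 X))) (mx_deriv_expmx0 X).
have := mx_deriv_mem (V := V) D.
rewrite scale0r expmx0 trmx1 mulmx1 mul1mx VE; apply => t.
have : sigma_set ty (dagger (expmx (- t *: X)) s) by exact: HS.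
by rewrite VE /= daggerE invmx_expmx scaleNr opprK.
Qed.

Lemma classification (G : set 'M[R]_4) : E2 G ->
  exists2 m : member R, admissible m & conjugate_GL2 G (member_group m).
Proof.
move=> [_ _ [V [H [V0 VSym [Hsub [U HU UB] Hgen] H1 [HV ->]]]]].
have [HGL H01 _ _] := Hsub.
have eH : exp_generated H by split.
have [ty [g0 [g0u VE]]] := sigma_normal_form V0 VSym.
have Llie : lie_set (lie_algebra H).
  rewrite HU; split=> /=; first exact: mem0v.
  - by move=> X Y; exact: memvD.
  - by move=> k X; exact: memvZ.
  - by move=> X Y; exact: UB.
(* If the Lie algebra were zero, every element of H would be a product of copies of [expmx 0], that
   is 1. *)
have LX : exists2 X, conj_set g0 (lie_algebra H) X & X != 0.
  suff [X HX X0] : exists2 X, lie_algebra H X & X != 0.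
    exists (g0 *m X *m invmx g0); first by exists X.
    apply: contraNneq X0 => E; rewrite -[X](mulKmx g0u) -[g0 *m X](mulmxKV g0u) E.
    by rewrite mul0mx mulmx0.
  apply: contrapT => noX; apply: H1; apply/seteqP; split=> [h|_ -> //].
  move=> /Hgen[s sH ->] /=; elim: s sH => [|X s IH] sH; first by rewrite big_nil.
  rewrite big_cons IH => [|Y Ys]; last by apply: sH; rewrite inE Ys orbT.
  have -> : X = 0.
    apply/eqP; apply: contraT => X0; case: noX; exists X => //.
    by apply: sH; rewrite mem_head.
  by rewrite expmx0 mulr1.
have Lsub : lie_algebra (conj_set g0 H) `<=` stab_alg ty.
  apply: lie_algebra_stab => _ s [h Hh <-] sS; have hu := HGL _ Hh; rewrite /GL/= in hu.
  have : [set` V] (dagger (invmx g0) s).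
    by rewrite -(dagger_imageV g0u VE); exists s.
  move=> sV; rewrite !daggerM ?unitmx_mul ?unitmx_inv ?g0u// -VE.
  exists (dagger h (dagger (invmx g0) s)) => //.
  by rewrite -(HV _ Hh); exists (dagger (invmx g0) s).
have := classify_algebra (lie_set_conj g0u Llie).
rewrite -lie_algebra_conj// => /(_ ty Lsub)[|m [g1 [g1u mA mty gS gL]]].
  by rewrite lie_algebra_conj.
(* [g0] normalises Sigma; [g1] then normalises the algebra inside the stabilizer. *)
exists m => //; exists (g1 *m g0); first by rewrite /GL/= unitmx_mul g1u.
rewrite conj_semidirect// ?unitmx_mul ?g1u// /member_group member_SigmaE mty.
rewrite -dagger_imageM// VE gS -conj_setM//; congr semidirect.
apply: exp_generated_eq; last by rewrite lie_algebra_member lie_algebra_conj.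
  by apply: exp_generated_conj => //; exact: exp_generated_conj.
exact: exp_generated_member.
Qed.

End ConjugateGroups.

Theorem theorem1 (R : realType) :
  (forall G : set 'M[R]_4, E2 G ->
     exists2 m : member R, admissible m & conjugate_GL2 G (member_group m)) /\
  (forall m : member R, admissible m ->
     has_dimension (member_group m) (member_dim m)) /\
  (forall m m' : member R, admissible m -> admissible m' -> m <> m' ->
     ~ conjugate_GL2 (member_group m) (member_group m')).
Proof.
split; first exact: classification.
split=> [m _|m m' mA mA' mm' /(member_group_inj mA mA')//].
exact: has_dimension_member.
Qed.
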